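(* Let $N\geq 1$, let $c_1<\cdots<c_N$ be real numbers in $(-\sqrt2,\sqrt2)$, let $\theta_0\in\mathbb{R}$ and $x_1,\dots,x_N\in\mathbb{R}$ be arbitrary and fixed. Then there exists a smooth solution $u:\mathbb{R}\times\mathbb{R}\to\mathbb{C}$, $(t,x)\mapsto u(t,x)$, of the Gross-Pitaevskii equation $$i\partial_t u+\partial_x^2u+(1-|u|^2)u=0\quad\text{on }\mathbb{R}\times\mathbb{R}$$ such that for all $x\in\mathbb{R}$, all $k\in\{1,\dots,N\}$ and each choice of sign $\pm$, $$\lim_{t\to\pm\infty}u(t,x+c_kt)=e^{i(\theta_0+\theta_k)}A_k^{\pm}\,U_{c_k}(x-x_k-\eta_k^{\pm}),$$ where $$\theta_j=\arccos\left(\frac{c_j}{\sqrt2}\right),\quad j=1,\dots,N,$$ $$\eta_k^+=-\frac{1}{\sqrt{2-c_k^2}}\sum_{j=k+1}^{N}\log\left(\frac{2-c_jc_k+\sqrt{2-c_j^2}\sqrt{2-c_k^2}}{2-c_jc_k-\sqrt{2-c_j^2}\sqrt{2-c_k^2}}\right),\qquad A_k^+=e^{2i\sum_{j=k+1}^N\theta_j},$$ $$\eta_k^-=-\frac{1}{\sqrt{2-c_k^2}}\sum_{j=1}^{k-1}\log\left(\frac{2-c_jc_k+\sqrt{2-c_j^2}\sqrt{2-c_k^2}}{2-c_jc_k-\sqrt{2-c_j^2}\sqrt{2-c_k^2}}\right),\qquad A_k^-=e^{2i\sum_{j=1}^{k-1}\theta_j}.$$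
   Context: For $c\in(-\sqrt2,\sqrt2)$, the soliton profile $U_c:\mathbb{R}\to\mathbb{C}$ is $$U_c(x)=\sqrt{1-\frac{c^2}{2}}\,\tanh\left(\sqrt{1-\frac{c^2}{2}}\,\frac{x}{\sqrt2}\right)+i\frac{c}{\sqrt2}.$$ Empty sums are $0$. *)

(* Defs.v *)
From Stdlib Require Import Reals.
From Coquelicot Require Import Coquelicot.
Open Scope R_scope.

(* [C] is seen throughout as a normed space over [R]: the partial derivatives
   are taken with respect to the real variables t and x. *)
Definition is_partial_t (f ft : R -> R -> C) : Prop :=
  forall t x : R, @is_derive R_AbsRing C_R_NormedModule (fun s => f s x) t (ft t x).

Definition is_partial_x (f fx : R -> R -> C) : Prop :=
  forall t x : R, @is_derive R_AbsRing C_R_NormedModule (fun y => f t y) x (fx t x).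

Fixpoint class_Cn (n : nat) (f : R -> R -> C) : Prop :=
  match n with
  | O => forall p : R * R, continuous (fun q : R * R => f (fst q) (snd q)) p
  | S m => exists ft fx : R -> R -> C,
      is_partial_t f ft /\ is_partial_x f fx /\ class_Cn m ft /\ class_Cn m fx
  end.

Definition smooth (f : R -> R -> C) : Prop := forall n : nat, class_Cn n f.

Definition GP_solution (u : R -> R -> C) : Prop :=
  exists ut ux uxx : R -> R -> C,
    is_partial_t u ut /\ is_partial_x u ux /\ is_partial_x ux uxx /\
    forall t x : R,
      (Ci * ut t x + uxx t x + (1 - RtoC (Cmod (u t x) ^ 2)) * u t x = 0)%C.

Definition expi (a : R) : C := (cos a, sin a).

Definition soliton (c x : R) : C :=
  (RtoC (sqrt (1 - c ^ 2 / 2) * tanh (sqrt (1 - c ^ 2 / 2) * (x / sqrt 2)))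
   + Ci * RtoC (c / sqrt 2))%C.

Definition theta (c : nat -> R) (j : nat) : R := acos (c j / sqrt 2).

Definition log_term (c : nat -> R) (j k : nat) : R :=
  ln ((2 - c j * c k + sqrt (2 - c j ^ 2) * sqrt (2 - c k ^ 2)) /
      (2 - c j * c k - sqrt (2 - c j ^ 2) * sqrt (2 - c k ^ 2))).

(* [sum_n_m f a b] is 0 when b < a; below k ranges over 1, ..., N. *)
Definition eta_plus (N : nat) (c : nat -> R) (k : nat) : R :=
  - (1 / sqrt (2 - c k ^ 2)) * sum_n_m (fun j => log_term c j k) (k + 1) N.

Definition eta_minus (c : nat -> R) (k : nat) : R :=
  - (1 / sqrt (2 - c k ^ 2)) * sum_n_m (fun j => log_term c j k) 1 (k - 1).

Definition A_plus (N : nat) (c : nat -> R) (k : nat) : C :=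
  expi (2 * sum_n_m (theta c) (k + 1) N).

Definition A_minus (c : nat -> R) (k : nat) : C :=
  expi (2 * sum_n_m (theta c) 1 (k - 1)).

(* Main.v *)
(** Put z_j = e^{i theta_j}, z'_j = 1 / z_j, nu_j = sqrt (2 - c_j^2) and
    E_j = exp (- nu_j (x - c_j t - x_j)). For a weight w let tau(w) be the sum over S in {1..N}
    of prod_{i in S} w_i prod_{i < j in S} a_ij, where a_ij = |z_i - z_j|^2 / |z_i - z'_j|^2.
    The solution is u = i e^{i theta_0} tau(E z^2) / tau(E). It is smooth because tau(E) > 0,
    and its limits along x + c_k t are obtained by keeping the dominant subsets S.

    For the equation, T(y) = tau(E_j (y - z_j) / (y - z'_j)) / tau(E) has simple poles at the
    z'_j, its residue there is (z'_j - z_j) E_j T(z_j), it equals 1 at infinity and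
    tau(E z^2) / tau(E) at 0. A function of y with such poles and residues that vanishes at
    infinity is zero, because the Cauchy matrix 1 / (conj a_j + a_k) is positive for
    Re a_j > 0. With psi = e^{i (k x - k^2 t)} T(y) and k = y / sqrt 2, this uniqueness applies
    to i psi_t + psi_xx + V psi, for V making it vanish at infinity, and to
    psi_x - i (y + 1 / y) psi / sqrt 2 corrected by a companion function that removes the pole
    at 0. The first vanishing, at y = 0, is the Schroedinger equation for u with potential V;
    the second one, at infinity, gives V = 1 - |u|^2. *)

Require Import Defs.
From Stdlib Require Import Reals Lra Lia List FunctionalExtensionality.
From Coquelicot Require Import Coquelicot.
Open Scope R_scope.

(** * Limits, derivatives and smoothness in C *)

Lemma filterlim_C_iff {T : Type} {F : (T -> Prop) -> Prop} {FF : Filter F}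
  (f : T -> C) (l : C) :
  filterlim f F (locally l) <->
  filterlim (fun x => fst (f x)) F (locally (fst l)) /\
  filterlim (fun x => snd (f x)) F (locally (snd l)).
Proof.
rewrite !filterlim_locally; split.
- intro H; split; intro eps; generalize (H eps); apply filter_imp;
    now intros x [H1 H2].
- intros [H1 H2] eps; generalize (filter_and _ _ (H1 eps) (H2 eps)).
  apply filter_imp; intros x [? ?]; now split.
Qed.

Lemma filterlim_C_plus {T : Type} {F : (T -> Prop) -> Prop} {FF : Filter F}
  (f g : T -> C) (a b : C) :
  filterlim f F (locally a) -> filterlim g F (locally b) ->
  filterlim (fun x => f x + g x)%C F (locally (a + b)%C).
Proof.
intros Hf Hg.
apply (filterlim_comp_2 _ _ Cplus Hf Hg).
exact (@filterlim_plus R_AbsRing C_R_NormedModule a b).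
Qed.

Lemma filterlim_R_mult {T : Type} {F : (T -> Prop) -> Prop} {FF : Filter F}
  (f g : T -> R) (a b : R) :
  filterlim f F (locally a) -> filterlim g F (locally b) ->
  filterlim (fun x => f x * g x) F (locally (a * b)).
Proof.
intros Hf Hg.
exact (filterlim_comp_2 _ _ Rmult Hf Hg (@filterlim_mult R_AbsRing a b)).
Qed.

Lemma filterlim_R_plus {T : Type} {F : (T -> Prop) -> Prop} {FF : Filter F}
  (f g : T -> R) (a b : R) :
  filterlim f F (locally a) -> filterlim g F (locally b) ->
  filterlim (fun x => f x + g x) F (locally (a + b)).
Proof.
intros Hf Hg.
exact (filterlim_comp_2 _ _ Rplus Hf Hg (@filterlim_plus R_AbsRing R_NormedModule a b)).
Qed.

Lemma filterlim_R_opp {T : Type} {F : (T -> Prop) -> Prop} {FF : Filter F}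
  (f : T -> R) (a : R) :
  filterlim f F (locally a) -> filterlim (fun x => - f x) F (locally (- a)).
Proof.
intros Hf.
exact (filterlim_comp _ _ _ f Ropp _ _ _ Hf (@filterlim_opp R_AbsRing R_NormedModule a)).
Qed.

Lemma filterlim_R_inv {T : Type} {F : (T -> Prop) -> Prop} {FF : Filter F}
  (f : T -> R) (a : R) :
  a <> 0 ->
  filterlim f F (locally a) -> filterlim (fun x => / f x) F (locally (/ a)).
Proof.
intros Ha Hf.
apply (filterlim_comp _ _ _ f Rinv _ _ _ Hf).
apply (filterlim_Rbar_inv (Finite a)).
now intros E; injection E.
Qed.

Lemma filterlim_C_mult {T : Type} {F : (T -> Prop) -> Prop} {FF : Filter F}
  (f g : T -> C) (a b : C) :
  filterlim f F (locally a) -> filterlim g F (locally b) ->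
  filterlim (fun x => f x * g x)%C F (locally (a * b)%C).
Proof.
rewrite !filterlim_C_iff; intros [H1 H2] [H3 H4]; simpl; split.
- apply filterlim_R_plus; [|apply filterlim_R_opp]; now apply filterlim_R_mult.
- apply filterlim_R_plus; now apply filterlim_R_mult.
Qed.

Lemma Cnorm2_neq_0 (a : C) : a <> 0%C -> fst a ^ 2 + snd a ^ 2 <> 0.
Proof.
intros Ha E; apply Ha; destruct a as [x y]; simpl in E.
assert (x = 0) by nra; assert (y = 0) by nra; now subst.
Qed.

Lemma filterlim_C_inv {T : Type} {F : (T -> Prop) -> Prop} {FF : Filter F}
  (f : T -> C) (a : C) :
  a <> 0%C ->
  filterlim f F (locally a) -> filterlim (fun x => / f x)%C F (locally (/ a)%C).
Proof.
intros Ha; rewrite !filterlim_C_iff; intros [H1 H2].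
assert (N : filterlim (fun x => / (fst (f x) ^ 2 + snd (f x) ^ 2)) F
  (locally (/ (fst a ^ 2 + snd a ^ 2)))).
{ apply filterlim_R_inv; [now apply Cnorm2_neq_0|].
  apply filterlim_R_plus; simpl;
    repeat apply filterlim_R_mult; trivial; apply filterlim_const. }
unfold Cinv; split; cbn -[pow]; unfold Rdiv; apply filterlim_R_mult; trivial.
now apply filterlim_R_opp.
Qed.

(** The projections are linear, which gives one direction. For the other, f is recombined from its
    components and the constant vectors (1, 0) and (0, 1). *)
Lemma is_derive_C_iff (f : R -> C) (x : R) (l : C) :
  @is_derive R_AbsRing C_R_NormedModule f x l <->
  is_derive (fun y => fst (f y)) x (fst l) /\
  is_derive (fun y => snd (f y)) x (snd l).
Proof.
split.
- intros H; split.
  + apply (filterdiff_comp' f fst x _ fst H).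
    apply filterdiff_linear, is_linear_fst.
  + apply (filterdiff_comp' f snd x _ snd H).
    apply filterdiff_linear, is_linear_snd.
- intros [H1 H2].
  generalize (@is_derive_plus R_AbsRing C_R_NormedModule _ _ _ _ _
    (@is_derive_scal_l R_AbsRing C_R_NormedModule _ x _ (1, 0)%R H1)
    (@is_derive_scal_l R_AbsRing C_R_NormedModule _ x _ (0, 1)%R H2)).
  assert (K : forall a : C, plus (@scal R_AbsRing C_R_NormedModule (fst a) (1, 0))
    (@scal R_AbsRing C_R_NormedModule (snd a) (0, 1)) = a).
  { intros [a b]; unfold plus, scal; simpl.
    unfold prod_plus, prod_scal; simpl. unfold scal, plus; simpl; unfold mult; simpl.
    apply injective_projections; simpl; ring. }
  intros H; rewrite <- (K l).
  revert H; apply is_derive_ext; intros t; apply K.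
Qed.

Lemma is_derive_C_unique (f : R -> C) (x : R) (l l' : C) :
  @is_derive R_AbsRing C_R_NormedModule f x l ->
  @is_derive R_AbsRing C_R_NormedModule f x l' -> l = l'.
Proof.
rewrite !is_derive_C_iff; intros [H1 H2] [H3 H4].
apply injective_projections.
- now rewrite <- (is_derive_unique _ _ _ H1), <- (is_derive_unique _ _ _ H3).
- now rewrite <- (is_derive_unique _ _ _ H2), <- (is_derive_unique _ _ _ H4).
Qed.

Lemma is_derive_C_const (a : C) (x : R) :
  @is_derive R_AbsRing C_R_NormedModule (fun _ => a) x (RtoC 0).
Proof. exact (@is_derive_const R_AbsRing C_R_NormedModule a x). Qed.

Lemma is_derive_C_plus (f g : R -> C) (x : R) (a b : C) :
  @is_derive R_AbsRing C_R_NormedModule f x a ->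
  @is_derive R_AbsRing C_R_NormedModule g x b ->
  @is_derive R_AbsRing C_R_NormedModule (fun y => f y + g y)%C x (a + b)%C.
Proof. exact (@is_derive_plus R_AbsRing C_R_NormedModule f g x a b). Qed.

Lemma is_derive_C_mult (f g : R -> C) (x : R) (a b : C) :
  @is_derive R_AbsRing C_R_NormedModule f x a ->
  @is_derive R_AbsRing C_R_NormedModule g x b ->
  @is_derive R_AbsRing C_R_NormedModule (fun y => f y * g y)%C x
    (a * g x + f x * b)%C.
Proof.
rewrite !is_derive_C_iff; intros [H1 H2] [H3 H4]; simpl.
(* The components are made opaque below, so that [auto_derive] treats them as unknown differentiable
   functions. *)
set (f1 := fun y => fst (f y)) in *; set (f2 := fun y => snd (f y)) in *.
set (g1 := fun y => fst (g y)) in *; set (g2 := fun y => snd (g y)) in *.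
change (fst (f x)) with (f1 x); change (snd (f x)) with (f2 x).
change (fst (g x)) with (g1 x); change (snd (g x)) with (g2 x).
split; [change (is_derive (fun y => f1 y * g1 y - f2 y * g2 y) x
    (fst a * g1 x - snd a * g2 x + (f1 x * fst b - f2 x * snd b)))
  | change (is_derive (fun y => f1 y * g2 y + f2 y * g1 y) x
    (fst a * g2 x + snd a * g1 x + (f1 x * snd b + f2 x * fst b)))];
change (is_derive f1 x (fst a)) in H1; change (is_derive f2 x (snd a)) in H2;
change (is_derive g1 x (fst b)) in H3; change (is_derive g2 x (snd b)) in H4;
clearbody f1 f2 g1 g2; auto_derive; repeat split; try (eexists; eassumption);
change (Derive (fun y : R => f1 y) x) with (Derive f1 x);
change (Derive (fun y : R => f2 y) x) with (Derive f2 x);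
change (Derive (fun y : R => g1 y) x) with (Derive g1 x);
change (Derive (fun y : R => g2 y) x) with (Derive g2 x);
rewrite (is_derive_unique _ _ _ H1), (is_derive_unique _ _ _ H2),
  (is_derive_unique _ _ _ H3), (is_derive_unique _ _ _ H4); ring.
Qed.

Lemma is_derive_C_inv (f : R -> C) (x : R) (a : C) :
  f x <> 0%C ->
  @is_derive R_AbsRing C_R_NormedModule f x a ->
  @is_derive R_AbsRing C_R_NormedModule (fun y => / f y)%C x
    (- (1) * a * / f x * / f x)%C.
Proof.
intros H0; rewrite !is_derive_C_iff; intros [H1 H2].
pose proof (Cnorm2_neq_0 _ H0) as H3.
set (f1 := fun y => fst (f y)) in *; set (f2 := fun y => snd (f y)) in *.
unfold Cinv; cbn -[pow].
change (fst (f x)) with (f1 x) in *; change (snd (f x)) with (f2 x) in *.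
split; match goal with |- is_derive _ _ ?v =>
  first [change (is_derive (fun y => f1 y / (f1 y ^ 2 + f2 y ^ 2)) x v)
  | change (is_derive (fun y => - f2 y / (f1 y ^ 2 + f2 y ^ 2)) x v)] end;
change (is_derive f1 x (fst a)) in H1; change (is_derive f2 x (snd a)) in H2;
clearbody f1 f2; auto_derive; repeat split; try (eexists; eassumption); trivial;
change (Derive (fun y : R => f1 y) x) with (Derive f1 x);
change (Derive (fun y : R => f2 y) x) with (Derive f2 x);
rewrite (is_derive_unique _ _ _ H1), (is_derive_unique _ _ _ H2); field; trivial.
Qed.

(* Unlike [class_Cn], this class asks for continuity at every order: it is then visibly
   decreasing in n, and the Leibniz rule gives stability under products by induction. *)
Fixpoint smooth_upto (n : nat) (f : R -> R -> C) : Prop :=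
  (forall p : R * R, continuous (fun q : R * R => f (fst q) (snd q)) p) /\
  match n with
  | O => True
  | S m => exists ft fx : R -> R -> C,
      is_partial_t f ft /\ is_partial_x f fx /\ smooth_upto m ft /\ smooth_upto m fx
  end.

Lemma smooth_upto_pred n f : smooth_upto (S n) f -> smooth_upto n f.
Proof.
revert f; induction n as [|n IH]; intros f [H (ft & fx & Ht & Hx & H1 & H2)].
- now split.
- split; trivial; exists ft, fx; auto.
Qed.

Lemma smooth_upto_class_Cn n f : smooth_upto n f -> class_Cn n f.
Proof.
revert f; induction n as [|n IH]; intros f [H K]; trivial.
destruct K as (ft & fx & Ht & Hx & H1 & H2); exists ft, fx; auto.
Qed.

Lemma smooth_upto_const n a : smooth_upto n (fun _ _ => a).
Proof.
revert a; induction n as [|n IH]; intros a; split; trivial;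
  try (intro; apply filterlim_const).
exists (fun _ _ => 0%C), (fun _ _ => 0%C); split; [|split; [|split]]; trivial;
  intros t x; apply is_derive_C_const.
Qed.

Lemma smooth_upto_plus n f g : smooth_upto n f -> smooth_upto n g ->
  smooth_upto n (fun t x => f t x + g t x)%C.
Proof.
revert f g; induction n as [|n IH]; intros f g [Hf Kf] [Hg Kg]; split; trivial;
  try (intro p; exact (filterlim_C_plus _ _ _ _ (Hf p) (Hg p))).
destruct Kf as (ft & fx & Ht & Hx & H1 & H2).
destruct Kg as (gt & gx & It & Ix & I1 & I2).
exists (fun t x => ft t x + gt t x)%C, (fun t x => fx t x + gx t x)%C.
split; [|split; [|split]]; try (apply IH; assumption);
  intros t x; apply is_derive_C_plus; auto.
Qed.

Lemma smooth_upto_mult n f g : smooth_upto n f -> smooth_upto n g ->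
  smooth_upto n (fun t x => f t x * g t x)%C.
Proof.
revert f g; induction n as [|n IH]; intros f g Df Dg.
- destruct Df as [Hf _], Dg as [Hg _]; split; trivial.
  intro p; exact (filterlim_C_mult _ _ _ _ (Hf p) (Hg p)).
(* In the Leibniz rule f and g stand beside the derivatives, so both are needed at order n too. *)
- pose proof (smooth_upto_pred _ _ Df) as Df'; pose proof (smooth_upto_pred _ _ Dg) as Dg'.
  destruct Df as [Hf (ft & fx & Ht & Hx & H1 & H2)].
  destruct Dg as [Hg (gt & gx & It & Ix & I1 & I2)].
  split; [intro p; exact (filterlim_C_mult _ _ _ _ (Hf p) (Hg p))|].
  exists (fun t x => ft t x * g t x + f t x * gt t x)%C,
    (fun t x => fx t x * g t x + f t x * gx t x)%C.
  split; [|split; [|split]]; try (apply smooth_upto_plus; apply IH; assumption).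
  + intros t x.
    exact (is_derive_C_mult (fun s => f s x) (fun s => g s x) t _ _ (Ht t x) (It t x)).
  + intros t x.
    exact (is_derive_C_mult (f t) (g t) x _ _ (Hx t x) (Ix t x)).
Qed.

(** The derivative of 1 / f is - f' / f^2, a product in which 1 / f occurs one order lower;
    induction on n closes. *)
Lemma smooth_upto_inv n (f : R -> R -> C) : (forall t x, f t x <> 0%C) ->
  smooth_upto n f -> smooth_upto n (fun t x => / f t x)%C.
Proof.
intros H0; induction n as [|n IH]; intros Df.
- destruct Df as [Hf _]; split; trivial.
  intro p; exact (filterlim_C_inv _ _ (H0 _ _) (Hf p)).
- pose proof (IH (smooth_upto_pred _ _ Df)) as Di.
  destruct Df as [Hf (ft & fx & Ht & Hx & H1 & H2)].
  split; [intro p; exact (filterlim_C_inv _ _ (H0 _ _) (Hf p))|].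
  exists (fun t x => - (1) * ft t x * / f t x * / f t x)%C,
    (fun t x => - (1) * fx t x * / f t x * / f t x)%C.
  split; [|split; [|split]]; try (repeat apply smooth_upto_mult; trivial; apply smooth_upto_const).
  + intros t x.
    exact (is_derive_C_inv (fun s => f s x) t _ (H0 t x) (Ht t x)).
  + intros t x.
    exact (is_derive_C_inv (f t) x _ (H0 t x) (Hx t x)).
Qed.

Definition Cexp_lin (a b d t x : R) : C := RtoC (exp (a * t + b * x + d)).

Lemma Cexp_lin_partial_t a b d :
  is_partial_t (Cexp_lin a b d) (fun t x => RtoC a * Cexp_lin a b d t x)%C.
Proof.
intros t x; rewrite is_derive_C_iff; unfold Cexp_lin; simpl; split; auto_derive; trivial; ring.
Qed.

Lemma Cexp_lin_partial_x a b d :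
  is_partial_x (Cexp_lin a b d) (fun t x => RtoC b * Cexp_lin a b d t x)%C.
Proof.
intros t x; rewrite is_derive_C_iff; unfold Cexp_lin; simpl; split; auto_derive; trivial; ring.
Qed.

Lemma smooth_upto_Cexp_lin n a b d : smooth_upto n (Cexp_lin a b d).
Proof.
assert (K : forall p : R * R,
  continuous (fun q : R * R => Cexp_lin a b d (fst q) (snd q)) p).
{ intros p; unfold Cexp_lin.
  apply (filterlim_C_iff (F := locally p)); simpl; split; [|apply filterlim_const].
  apply (continuous_comp (fun q : R * R => a * fst q + b * snd q + d) exp).
  - repeat apply @continuous_plus; try apply continuous_const.
    + apply (@continuous_scal_r _ R_AbsRing R_NormedModule a), continuous_fst.
    + apply (@continuous_scal_r _ R_AbsRing R_NormedModule b), continuous_snd.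
  - apply (ex_derive_continuous exp); auto_derive; trivial. }
induction n as [|n IH]; split; trivial.
eexists _, _; split; [apply Cexp_lin_partial_t|].
split; [apply Cexp_lin_partial_x|].
split; apply smooth_upto_mult; trivial; apply smooth_upto_const.
Qed.

(** * Partial fractions of tau functions *)

Fixpoint Csum (L : list nat) (f : nat -> C) : C :=
  match L with
  | nil => 0%C
  | j :: L' => (f j + Csum L' f)%C
  end.

Lemma Csum_ext L (f g : nat -> C) :
  (forall j, In j L -> f j = g j) -> Csum L f = Csum L g.
Proof.
induction L as [|j L IH]; intros H; simpl; trivial.
rewrite H, IH; auto with datatypes.
Qed.

Lemma Csum_plus L (f g : nat -> C) : Csum L (fun j => f j + g j)%C = (Csum L f + Csum L g)%C.
Proof. induction L as [|j L IH]; simpl; [|rewrite IH]; ring. Qed.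

Lemma Csum_scal L (a : C) (f : nat -> C) : Csum L (fun j => a * f j)%C = (a * Csum L f)%C.
Proof. induction L as [|j L IH]; simpl; [|rewrite IH]; ring. Qed.

Lemma Csum_zero L (f : nat -> C) : (forall j, In j L -> f j = 0%C) -> Csum L f = 0%C.
Proof.
intros H; rewrite (Csum_ext L f (fun j => 0 * 0)%C).
- rewrite Csum_scal; ring.
- intros j Hj; rewrite H; trivial; ring.
Qed.

Lemma Csum_conj L (f : nat -> C) : Cconj (Csum L f) = Csum L (fun j => Cconj (f j)).
Proof.
induction L as [|j L IH]; simpl.
- apply injective_projections; simpl; ring.
- now rewrite Cplus_conj, IH.
Qed.

(* [tau a L v w] is the sum over all S included in L of
   prod_{i in S} w_i * prod_{i notin S} v_i * prod_{i, j in S, i before j} a_ij. *)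
Fixpoint tau (a : nat -> nat -> C) (L : list nat) (v w : nat -> C) : C :=
  match L with
  | nil => 1%C
  | i :: L' => (v i * tau a L' v w + w i * tau a L' v (fun j => w j * a i j))%C
  end.

(** With [ones] for v, [tau] is the usual tau function. Other v serve the asymptotics, where weights
    that tend to infinity are rescaled. *)
Definition ones : nat -> C := fun _ => 1%C.

Lemma tau_ext a L v v' w w' :
  (forall j, In j L -> v j = v' j) -> (forall j, In j L -> w j = w' j) ->
  tau a L v w = tau a L v' w'.
Proof.
revert w w'; induction L as [|i L IH]; intros w w' Hv Hw; simpl; trivial.
rewrite Hv, Hw by auto with datatypes.
rewrite (IH w w'), (IH (fun j => w j * a i j)%C (fun j => w' j * a i j)%C);
  auto with datatypes.
intros j Hj; rewrite Hw; auto with datatypes.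
Qed.

Section PartialFractions.

Variables z p : nat -> C.

(** The two-soliton interaction coefficient, for free zeros z and poles p. For p_j = conj z_j it is
    |z_j - z_i|^2 / |z_j - p_i|^2. *)
Definition inter (i j : nat) : C :=
  ((z j - z i) * (p j - p i) / ((z j - p i) * (p j - z i)))%C.

(** For p_j = conj z_j with Im z_j > 0, this is a Blaschke factor of the upper half-plane. *)
Definition phi (j : nat) (y : C) : C := ((y - z j) / (y - p j))%C.

Definition generic (L : list nat) : Prop :=
  NoDup L /\
  forall i j, In i L -> In j L -> z i <> p j /\ (i <> j -> p i <> p j).

Lemma Csub_neq_0 (a b : C) : a <> b -> (a - b)%C <> 0%C.
Proof. intros H E; apply H. replace a with (a - b + b)%C by ring; rewrite E; ring. Qed.

(** Induction on L: the head i contributes E_i phi_i(y) times a tau function of L with weights E_j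
    a_ij. Its residue at p_i has the stated form because a_ij phi_j(p_i) = phi_j(z_i) and phi_i(z_i)
    = 0. *)
Lemma tau_partial_fractions L : generic L ->
  forall (E : nat -> C) (y : C), (forall j, In j L -> y <> p j) ->
  tau inter L ones (fun i => E i * phi i y)%C =
  (tau inter L ones E + Csum L (fun j => (p j - z j) / (y - p j) * E j *
     tau inter L ones (fun i => E i * phi i (z j))))%C.
Proof.
induction L as [|i L IH]; intros [HN HG] E y Hy; simpl; [ring|].
assert (GL : generic L).
{ split; [now inversion HN|]; intros; apply HG; now right. }
assert (Hi : forall j, In j L -> i <> j).
{ intros j Hj e; subst j; now inversion HN. }
assert (Hphi : forall e y', tau inter L ones (fun j => E j * phi j y' * inter i j * e)%C =
  tau inter L ones (fun j => E j * inter i j * e * phi j y')%C).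
{ intros; apply tau_ext; intros; trivial; ring. }
rewrite (IH GL E y) by (intros; apply Hy; now right).
assert (Hc : forall y', tau inter L ones (fun j => E j * phi j y' * inter i j)%C =
  tau inter L ones (fun j => E j * inter i j * phi j y')%C).
{ intros; apply tau_ext; intros; trivial; ring. }
rewrite Hc, (IH GL (fun j => E j * inter i j)%C y) by (intros; apply Hy; now right).
(* This is the identity that dictates the formula for [inter]: it trades an evaluation at the pole
   p_i for one at the zero z_i. *)
assert (Hz : tau inter L ones (fun j => E j * phi j (z i))%C =
  tau inter L ones (fun j => E j * inter i j * phi j (p i))%C).
{ apply tau_ext; intros j Hj; trivial.
  destruct (HG i j) as [H1 H2]; [now left|now right|].
  destruct (HG j i) as [H3 _]; [now right|now left|].
  unfold inter, phi; field.
  repeat split; apply Csub_neq_0; auto; try (intro e; apply H2; auto; now rewrite e). }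
rewrite Hz, (IH GL (fun j => E j * inter i j)%C (p i)).
2: { intros j Hj; apply (HG i j); auto with datatypes. }
set (S1 := tau inter L ones (fun j => E j * inter i j)%C).
(* Termwise, phi_i(y) / (y - p_j) = phi_i(p_j) / (y - p_j) + (p_i - z_i) / ((p_i - p_j) (y - p_i)),
   combined with a_ij phi_i(p_j) = phi_i(z_j). *)
assert (HE : Csum L (fun j => (p j - z j) / (y - p j) * E j *
     (ones i * tau inter L ones (fun i0 : nat => E i0 * phi i0 (z j)) +
      E i * phi i (z j) *
      tau inter L ones (fun j0 : nat => E j0 * phi j0 (z j) * inter i j0)))%C =
  (Csum L (fun j => (p j - z j) / (y - p j) * E j *
     tau inter L ones (fun i0 => E i0 * phi i0 (z j))) +
   E i * phi i y * Csum L (fun j => (p j - z j) / (y - p j) * (E j * inter i j) *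
     tau inter L ones (fun i0 => E i0 * inter i i0 * phi i0 (z j))) +
   (- ((p i - z i) / (y - p i)) * E i) *
     Csum L (fun j => (p j - z j) / (p i - p j) * (E j * inter i j) *
       tau inter L ones (fun i0 => E i0 * inter i i0 * phi i0 (z j))))%C).
{ rewrite <- !Csum_scal, <- !Csum_plus; apply Csum_ext; intros j Hj.
  rewrite Hc.
  destruct (HG i j) as [H1 H2]; [now left|now right|].
  destruct (HG j i) as [H3 _]; [now right|now left|].
  pose proof (Hy i (or_introl eq_refl)); pose proof (Hy j (or_intror Hj)).
  unfold ones, inter, phi; field.
  repeat split; apply Csub_neq_0; auto; try (intro e; apply H2; auto; now rewrite e). }
rewrite HE.
destruct (HG i i) as [H1 _]; [now left|now left|].
pose proof (Hy i (or_introl eq_refl)).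
repeat match goal with |- context [Csum L ?f] =>
  let Q := fresh "Q" in set (Q := Csum L f) end.
repeat match goal with |- context [tau inter L ?v ?f] =>
  let Q := fresh "Q" in set (Q := tau inter L v f) end.
unfold ones, phi; field.
repeat split; apply Csub_neq_0; auto.
Qed.

End PartialFractions.

(** * Positivity of Cauchy matrices *)

Section CauchyForm.

Variable a : nat -> C.

Definition cauchy_form (L : list nat) (r : nat -> C) : C :=
  Csum L (fun j => Csum L (fun k => Cconj (r j) * r k / (Cconj (a j) + a k)))%C.

Lemma Cadd_conj_neq_0 (x y : C) : 0 < Re x -> 0 < Re y -> (Cconj x + y)%C <> 0%C.
Proof.
intros Hx Hy E; apply (f_equal Re) in E; unfold Re in *; simpl in E; lra.
Qed.

Lemma Re_Csum_ge_0 L (f : nat -> C) : (forall j, In j L -> 0 <= Re (f j)) -> 0 <= Re (Csum L f).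
Proof.
induction L as [|j L IH]; intros H; simpl.
- unfold Re; simpl; lra.
- assert (0 <= Re (f j)) by (apply H; now left).
  assert (0 <= Re (Csum L f)) by (apply IH; intros; apply H; now right).
  unfold Re in *; simpl; lra.
Qed.

(* The Schur complement of the leading entry of a Cauchy matrix is again a Cauchy matrix,
   up to a diagonal congruence. *)
Lemma cauchy_form_ge_0 L r : (forall j, In j L -> 0 < Re (a j)) ->
  0 <= Re (cauchy_form L r).
Proof.
revert r; induction L as [|i L IH]; intros r Ha; [unfold Re; simpl; lra|].
assert (Hi : 0 < Re (a i)) by (apply Ha; now left).
set (r' := fun k => (r k * (a k - a i) / (Cconj (a i) + a k))%C).
set (S := Csum (i :: L) (fun k => r k / (Cconj (a i) + a k))%C).
(* Termwise this is (conj a_j + a_i) (conj a_i + a_k) = (conj a_i + a_i) (conj a_j + a_k) + (conj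
   a_j - conj a_i) (a_k - a_i). The entry of [r'] at i vanishes, which leaves a form on L. *)
assert (E : cauchy_form (i :: L) r =
  ((Cconj (a i) + a i) * (Cconj S * S) + cauchy_form (i :: L) r')%C).
{ unfold cauchy_form, S.
  rewrite Csum_conj.
  rewrite (Cmult_comm (Csum (i :: L) (fun j => Cconj _))), Cmult_assoc, <- Csum_scal.
  rewrite <- Csum_plus; apply Csum_ext; intros j Hj.
  rewrite Cmult_comm, Cmult_assoc, <- Csum_scal, <- Csum_plus.
  apply Csum_ext; intros k Hk.
  pose proof (Ha _ Hj) as Hj'; pose proof (Ha _ Hk) as Hk'.
  pose proof (Cadd_conj_neq_0 _ _ Hj' Hk').
  pose proof (Cadd_conj_neq_0 _ _ Hj' Hi) as N1.
  pose proof (Cadd_conj_neq_0 _ _ Hi Hk').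
  unfold r'; rewrite !Cdiv_conj, !Cmult_conj, !Cminus_conj, !Cplus_conj, !Cconj_conj.
  2,3: rewrite ?Cplus_conj, ?Cconj_conj; try assumption.
  2,3: apply Cadd_conj_neq_0; assumption.
  assert (N2 : (a i + Cconj (a j))%C <> 0%C) by now rewrite Cplus_comm.
  field; repeat split; trivial. }
assert (E' : cauchy_form (i :: L) r' = cauchy_form L r').
{ assert (H0 : r' i = 0%C) by (unfold r', Cdiv; ring).
  assert (H0' : Cconj (r' i) = 0%C).
  { rewrite H0; apply injective_projections; simpl; ring. }
  unfold cauchy_form; simpl; rewrite H0', H0.
  rewrite (Csum_zero L (fun k => (0 * r' k / (Cconj (a i) + a k))%C))
    by (intros; unfold Cdiv; ring).
  replace (0 * 0 / (Cconj (a i) + a i) + 0)%C with (RtoC 0) by (unfold Cdiv; ring).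
  rewrite Cplus_0_l; apply Csum_ext; intros j _; unfold Cdiv; ring. }
rewrite E, E'.
assert (K : 0 <= Re (cauchy_form L r')) by (apply IH; intros; apply Ha; now right).
revert K; unfold Re in *; destruct (cauchy_form L r') as [q1 q2], S as [s1 s2],
  (a i) as [a1 a2]; simpl in *; intros K.
ring_simplify; nra.
Qed.

End CauchyForm.

Lemma Re_Csum_eq_0 L (f : nat -> C) : (forall j, In j L -> Re (f j) <= 0) -> 0 <= Re (Csum L f) ->
  forall j, In j L -> Re (f j) = 0.
Proof.
intros H; induction L as [|i L IH]; simpl; intros K j Hj; [contradiction|].
assert (Re (f i) <= 0) by (apply H; now left).
assert (Re (Csum L f) <= 0).
{ pose proof (Re_Csum_ge_0 L (fun j => (- (1)) * f j)%C) as P.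
  rewrite Csum_scal in P.
  assert (Q : 0 <= Re (- (1) * Csum L f)).
  { apply P; intros j' Hj'; pose proof (H j' (or_intror Hj')); unfold Re in *; simpl; lra. }
  unfold Re in *; simpl in Q; lra. }
unfold Re in *; simpl in K.
destruct Hj as [<-|Hj]; [lra|apply IH; trivial; [|lra]].
intros; apply H; now right.
Qed.

(** With a_k = i conj z_k, one has Re a_k = Im z_k and conj a_j + a_k = - i (z_j - conj z_k). The
    system turns the Cauchy form of r into - sum_j |r_j|^2 / (2 Im z_j e_j); as the form is
    nonnegative, every r_j vanishes. *)
Lemma soliton_system_kernel (z : nat -> C) (e : nat -> R) (r : nat -> C) L :
  (forall j, In j L -> 0 < Im (z j)) -> (forall j, In j L -> 0 < e j) ->
  (forall j, In j L -> r j = (Cconj (z j) - z j) * e j *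
     Csum L (fun k => r k / (z j - Cconj (z k))))%C ->
  forall j, In j L -> r j = 0%C.
Proof.
intros Hz He Hr.
set (a := fun k => (Ci * Cconj (z k))%C).
assert (Ha : forall j, In j L -> 0 < Re (a j)).
{ intros j Hj; pose proof (Hz _ Hj); unfold a, Re, Im in *; simpl; lra. }
pose proof (cauchy_form_ge_0 a L r Ha) as Q.
assert (E : cauchy_form a L r =
  Csum L (fun j => - (1) * (Cconj (r j) * r j) / RtoC (2 * Im (z j) * e j))%C).
{ unfold cauchy_form; apply Csum_ext; intros j Hj.
  pose proof (Hz _ Hj) as Zj; pose proof (He _ Hj) as Ej.
  rewrite (Csum_ext _ _ (fun k => Cconj (r j) * Ci * (r k / (z j - Cconj (z k))))%C).
  2: { intros k Hk. pose proof (Hz _ Hk) as Zk.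
    pose proof (Cadd_conj_neq_0 _ _ (Ha _ Hj) (Ha _ Hk)) as N.
    assert (N' : (z j - Cconj (z k))%C <> 0%C).
    { intros F; apply (f_equal Im) in F; unfold Im in *; simpl in F; lra. }
    replace (Cconj (a j) + a k)%C with (- Ci * (z j - Cconj (z k)))%C in *
      by (unfold a; apply injective_projections; simpl; ring).
    assert (NI : (- Ci)%C <> 0%C) by (intro F; injection F; lra).
    assert (I2 : (/ - Ci)%C = Ci) by (apply injective_projections; simpl; field).
    rewrite <- I2 at 2; field; split; trivial.
    intro F; apply NI; rewrite F; ring. }
  rewrite Csum_scal.
  set (S := Csum L _).
  rewrite (Hr j Hj) at 3; fold S.
  assert (Hd : (Cconj (z j) - z j)%C = (- (2) * Im (z j) * Ci)%C).
  { destruct (z j) as [z1 z2]; apply injective_projections; simpl; ring. }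
  rewrite Hd.
  assert (N1 : RtoC (Im (z j)) <> 0%C) by (apply RtoC_neq_0 || (intro F; injection F; lra)).
  assert (N2 : RtoC (e j) <> 0%C) by (intro F; injection F; lra).
  rewrite !RtoC_mult; field; repeat split; trivial; intro F; injection F; lra. }
rewrite E in Q.
intros j Hj.
assert (Hneg : forall x : C, forall y, 0 < y ->
  Re (- (1) * (Cconj x * x) / RtoC y)%C = - (Re x ^ 2 + Im x ^ 2) / y).
{ intros [x1 x2] y Hy; unfold Re, Im; simpl; field; lra. }
assert (Hpos : forall j, In j L -> 0 < 2 * Im (z j) * e j).
{ intros i Hi; pose proof (Hz _ Hi); pose proof (He _ Hi).
  apply Rmult_lt_0_compat; lra. }
apply (Re_Csum_eq_0 L _) with (j := j) in Q; trivial.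
- rewrite Hneg in Q by auto. pose proof (Hpos _ Hj) as P.
  assert (Q' : Re (r j) ^ 2 + Im (r j) ^ 2 = 0).
  { apply Rmult_integral in Q; destruct Q as [Q|Q]; [lra|].
    pose proof (Rinv_0_lt_compat _ P); lra. }
  rewrite <- !Rsqr_pow2 in Q'; apply Rplus_sqr_eq_0 in Q'.
  now apply injective_projections.
- intros i Hi; pose proof (Hpos _ Hi) as P; rewrite Hneg by trivial.
  unfold Rdiv; pose proof (Rinv_0_lt_compat _ P).
  pose proof (pow2_ge_0 (Re (r i))); pose proof (pow2_ge_0 (Im (r i))); nra.
Qed.

(** * The Lax pair on residues *)

Section Flow.

(** In the application k_j = (p_j - z_j) E_j and b = i / sqrt 2. [S f j] is the value at z_j of
    sum_m f_m / (y - p_m), and [kernel] is the uniqueness of functions with such poles that vanish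
    at infinity. *)
Variables (L : list nat) (z p k : nat -> C) (b : C).

Hypothesis z_neq_p : forall i j, In i L -> In j L -> z i <> p j.
Hypothesis p_mult_z : forall j, In j L -> (p j * z j)%C = 1%C.
Hypothesis kernel : forall w : nat -> C,
  (forall j, In j L -> w j = (k j * Csum L (fun m => w m / (z j - p m)))%C) ->
  forall j, In j L -> w j = 0%C.

Let S (f : nat -> C) (j : nat) : C := Csum L (fun m => f m / (z j - p m))%C.

(* The [r_j] are the residues of the Baker-Akhiezer function 1 + sum_j r_j / (y - p_j);
   the hypotheses on [rt], [rx], [rxx] are the derivatives of the first one. *)
Lemma schroedinger_flow (r rt rx rxx : nat -> C) (V : C) :
  (forall j, In j L -> r j = k j * (1 + S r j))%C ->
  (forall j, In j L ->
    rt j = k j * (Ci * b ^ 2 * (z j ^ 2 - p j ^ 2) * (1 + S r j) + S rt j))%C ->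
  (forall j, In j L -> rx j = k j * (b * (z j - p j) * (1 + S r j) + S rx j))%C ->
  (forall j, In j L -> rxx j = k j * (b ^ 2 * (z j - p j) ^ 2 * (1 + S r j) +
    2 * b * (z j - p j) * S rx j + S rxx j))%C ->
  V = (- (2) * b * Csum L rx)%C ->
  (Ci * - Csum L (fun j => rt j / p j) - Csum L (fun j => rxx j / p j) +
    V * (1 - Csum L (fun j => r j / p j)) = 0)%C.
Proof.
intros Hr Ht Hx Hxx HV.
assert (I2 : (Ci * Ci = - (1))%C) by (apply injective_projections; simpl; ring).
assert (p_neq_0 : forall j, In j L -> p j <> 0%C).
{ intros j Hj F; pose proof (p_mult_z j Hj) as E; rewrite F in E.
  rewrite Cmult_0_l in E; injection E; lra. }
(* After division by the plane wave, the Schroedinger operator becomes i T_t + T_xx + 2 b y T_x + V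
   T; [w j] is its residue at p_j, and the choice of V makes it vanish at infinity. *)
set (w := fun j => (Ci * rt j + rxx j + 2 * b * p j * rx j + V * r j)%C).
assert (Hw : forall j, In j L -> w j = 0%C).
{ apply kernel; intros j Hj.
  assert (Sw : Csum L (fun m => w m / (z j - p m))%C =
    (Ci * S rt j + S rxx j + 2 * b * z j * S rx j + V * S r j +
      - (2) * b * Csum L rx)%C).
  { unfold S; rewrite <- !Csum_scal, <- !Csum_plus; apply Csum_ext; intros m Hm.
    unfold w; field; apply Csub_neq_0; auto. }
  (* The terms in b^2 (1 + S r) cancel since - (z^2 - p^2) + (z - p)^2 + 2 p (z - p) = 0. *)
  rewrite Sw, <- HV; unfold w; rewrite (Hr j Hj), (Ht j Hj), (Hx j Hj), (Hxx j Hj).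
  ring [I2]. }
(* Up to sign, this is the value at y = 0 of the function with residues [w j]; there the term 2 b y
   T_x only leaves its constant contribution at infinity. *)
assert (E : Csum L (fun j => w j / p j)%C = 0%C).
{ apply Csum_zero; intros j Hj; rewrite Hw by trivial; unfold Cdiv; ring. }
assert (E' : Csum L (fun j => w j / p j)%C =
  (Ci * Csum L (fun j => rt j / p j) + Csum L (fun j => rxx j / p j) +
   2 * b * Csum L rx + V * Csum L (fun j => r j / p j))%C).
{ rewrite <- !Csum_scal, <- !Csum_plus; apply Csum_ext; intros m Hm.
  unfold w; field; auto. }
rewrite E in E'.
transitivity (- (0))%C; [rewrite E'; rewrite HV|]; ring.
Qed.

(* The [s_j] are the residues of the companion function 1 / y + sum_j s_j / (y - p_j), the
   second component of the solution of the Lax pair. *)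
Lemma lax_flow (r rx s : nat -> C) (u u' : C) :
  (forall j, In j L -> r j = k j * (1 + S r j))%C ->
  (forall j, In j L -> rx j = k j * (b * (z j - p j) * (1 + S r j) + S rx j))%C ->
  (forall j, In j L -> s j = k j * (p j + S s j))%C ->
  u = (1 - Csum L (fun j => r j / p j))%C -> u' = (1 + Csum L s)%C ->
  Csum L rx = (b * (1 - u * u'))%C.
Proof.
intros Hr Hx Hs Hu Hu'.
assert (p_neq_0 : forall j, In j L -> p j <> 0%C).
{ intros j Hj F; pose proof (p_mult_z j Hj) as E; rewrite F in E.
  rewrite Cmult_0_l in E; injection E; lra. }
(* These are the residues at p_j of T_x - (b / y) T + b u (1 / y + sum_j s_j / (y - p_j)), whose
   pole at 0 cancels because T(0) = u. *)
set (w := fun j => (rx j + - b * (r j / p j) + b * u * s j)%C).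
assert (Hw : forall j, In j L -> w j = 0%C).
{ apply kernel; intros j Hj.
  assert (Zj : z j = (/ p j)%C).
  { rewrite <- (Cmult_1_l (/ p j)), <- (p_mult_z j Hj); field; auto. }
  assert (Sw : Csum L (fun m => w m / (z j - p m))%C =
    (S rx j + - b * p j * Csum L (fun m => r m / p m) +
      - b * p j * S r j + b * u * S s j)%C).
  { unfold S; rewrite <- !Csum_scal, <- !Csum_plus; apply Csum_ext; intros m Hm.
    assert (N : (1 - p j * p m)%C <> 0%C).
    { replace (1 - p j * p m)%C with (p j * (z j - p m))%C by
        (rewrite Zj; field; auto).
      apply Cmult_neq_0; [auto|apply Csub_neq_0; auto]. }
    unfold w; rewrite Zj; field; repeat split; auto.
    intro F; apply N; rewrite <- F; ring. }
  rewrite Sw; unfold w; rewrite (Hr j Hj), (Hx j Hj), (Hs j Hj).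
  replace (Csum L (fun m => r m / p m)%C) with (1 - u)%C by (rewrite Hu; ring).
  unfold Cdiv; rewrite <- Zj; ring. }
(* The sum of the residues is the coefficient of 1 / y at infinity. *)
assert (E : Csum L w = 0%C) by (apply Csum_zero; trivial).
assert (E' : Csum L w = (Csum L rx + - b * Csum L (fun m => r m / p m) + b * u * Csum L s)%C).
{ rewrite <- !Csum_scal, <- !Csum_plus; reflexivity. }
rewrite E in E'.
replace (Csum L (fun m => r m / p m)%C) with (1 - u)%C in E' by (rewrite Hu; ring).
rewrite Hu'.
transitivity (Csum L rx - 0)%C; [ring|rewrite E'; ring].
Qed.

End Flow.

(** * The N-soliton solution *)

(** A total operator, which names the derivatives of the residues without choosing witnesses;
    [dt_unique] identifies it with any partial derivative. *)
Definition dt (f : R -> R -> C) (t x : R) : C :=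
  (Derive (fun s => fst (f s x)) t, Derive (fun s => snd (f s x)) t).

Definition dx (f : R -> R -> C) (t x : R) : C :=
  (Derive (fun y => fst (f t y)) x, Derive (fun y => snd (f t y)) x).

Lemma dt_unique f ft : is_partial_t f ft -> dt f = ft.
Proof.
intros H; apply functional_extensionality; intro t.
apply functional_extensionality; intro x.
destruct (proj1 (is_derive_C_iff _ _ _) (H t x)) as [H1 H2].
apply injective_projections; simpl; now apply is_derive_unique.
Qed.

Lemma dx_unique f fx : is_partial_x f fx -> dx f = fx.
Proof.
intros H; apply functional_extensionality; intro t.
apply functional_extensionality; intro x.
destruct (proj1 (is_derive_C_iff _ _ _) (H t x)) as [H1 H2].
apply injective_projections; simpl; now apply is_derive_unique.
Qed.

Lemma smooth_upto_dt n f : smooth_upto (S n) f -> is_partial_t f (dt f) /\ smooth_upto n (dt f).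
Proof. intros [_ (ft & fx & Ht & Hx & H1 & H2)]; now rewrite (dt_unique _ _ Ht). Qed.

Lemma smooth_upto_dx n f : smooth_upto (S n) f -> is_partial_x f (dx f) /\ smooth_upto n (dx f).
Proof. intros [_ (ft & fx & Ht & Hx & H1 & H2)]; now rewrite (dx_unique _ _ Hx). Qed.

Lemma smooth_upto_tau n a L (w : nat -> R -> R -> C) :
  (forall j, smooth_upto n (w j)) -> smooth_upto n (fun t x => tau a L ones (fun j => w j t x)).
Proof.
revert w; induction L as [|i L IH]; intros w H; simpl; [apply smooth_upto_const|].
apply smooth_upto_plus; apply smooth_upto_mult; trivial; [apply smooth_upto_const|now apply IH|].
apply (IH (fun j t x => w j t x * a i j)%C); intros j.
apply smooth_upto_mult; trivial; apply smooth_upto_const.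
Qed.

Lemma is_derive_Csum L (f : nat -> R -> C) (x : R) (l : nat -> C) :
  (forall j, In j L -> @is_derive R_AbsRing C_R_NormedModule (f j) x (l j)) ->
  @is_derive R_AbsRing C_R_NormedModule
    (fun y => Csum L (fun j => f j y)) x (Csum L l).
Proof.
induction L as [|j L IH]; intros H; simpl; [apply is_derive_C_const|].
apply is_derive_C_plus; [apply H; now left|apply IH; intros; apply H; now right].
Qed.

Lemma is_derive_C_scal (k : C) (f : R -> C) (x : R) (l : C) :
  @is_derive R_AbsRing C_R_NormedModule f x l ->
  @is_derive R_AbsRing C_R_NormedModule (fun y => k * f y)%C x (k * l)%C.
Proof.
intros H; replace (k * l)%C with (0 * f x + k * l)%C by ring.
exact (is_derive_C_mult (fun _ => k) f x _ _ (is_derive_C_const k x) H).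
Qed.

Lemma is_derive_C_div (k : C) (f : R -> C) (x : R) (l : C) :
  @is_derive R_AbsRing C_R_NormedModule f x l ->
  @is_derive R_AbsRing C_R_NormedModule (fun y => f y / k)%C x (l / k)%C.
Proof.
intros H; replace (l / k)%C with (/ k * l)%C by (unfold Cdiv; ring).
apply (is_derive_ext (fun y => / k * f y)%C); [intros; apply Cmult_comm|].
now apply is_derive_C_scal.
Qed.

Lemma tau_conj (a : nat -> nat -> C) L (v w : nat -> C) :
  (forall i j, In i L -> In j L -> Cconj (a i j) = a i j) ->
  Cconj (tau a L v w) = tau a L (fun j => Cconj (v j)) (fun j => Cconj (w j)).
Proof.
revert w; induction L as [|i L IH]; intros w Ha; simpl.
- apply injective_projections; simpl; ring.
- rewrite Cplus_conj, !Cmult_conj, !IH by auto with datatypes.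
  f_equal; f_equal; apply tau_ext; trivial; intros j Hj.
  rewrite Cmult_conj, Ha; auto with datatypes.
Qed.

(** All terms are nonnegative, and the empty subset contributes 1. *)
Lemma tau_pos (a : nat -> nat -> C) L (w : nat -> C) :
  (forall i j, In i L -> In j L -> exists s, 0 <= s /\ a i j = RtoC s) ->
  (forall j, In j L -> exists s, 0 <= s /\ w j = RtoC s) ->
  exists s, 0 < s /\ tau a L ones w = RtoC s.
Proof.
revert w; induction L as [|i L IH]; intros w Ha Hw; simpl.
- exists 1; split; [lra|trivial].
- destruct (IH w) as (s1 & P1 & E1); auto with datatypes.
  destruct (IH (fun j => w j * a i j)%C) as (s2 & P2 & E2); auto with datatypes.
  { intros j Hj; destruct (Ha i j) as (s & P & E); auto with datatypes.
    destruct (Hw j) as (s' & P' & E'); auto with datatypes.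
    exists (s' * s); rewrite E, E', RtoC_mult; split; trivial; nra. }
  destruct (Hw i) as (s3 & P3 & E3); auto with datatypes.
  exists (s1 + s3 * s2); split; [nra|].
  rewrite E1, E2, E3, RtoC_plus, RtoC_mult; unfold ones; ring.
Qed.

(** The equation is gauge invariant: a constant of modulus 1 leaves |u|^2 unchanged. *)
Lemma GP_solution_phase (a : C) (u : R -> R -> C) :
  (a * Cconj a = 1)%C -> GP_solution u -> GP_solution (fun t x => a * u t x)%C.
Proof.
intros Ha (ut & ux & uxx & H1 & H2 & H3 & H4).
exists (fun t x => a * ut t x)%C, (fun t x => a * ux t x)%C, (fun t x => a * uxx t x)%C.
split; [|split; [|split]]; try (intros t x; now apply is_derive_C_scal).
intros t x; rewrite Cmod2_conj, Cmult_conj.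
replace (a * u t x * (Cconj a * Cconj (u t x)))%C with
  (a * Cconj a * (u t x * Cconj (u t x)))%C by ring.
rewrite Ha, Cmult_1_l, <- Cmod2_conj.
transitivity (a * 0)%C; [rewrite <- (H4 t x)|]; ring.
Qed.

Section NSoliton.

Variables (c x0 : nat -> R) (L : list nat).

(** This is e^{i theta_j} in algebraic form, which keeps the relations with c_j and nu_j polynomial;
    [expi_theta] makes the link. *)
Definition zeta (j : nat) : C := (c j / sqrt 2, sqrt (1 - c j ^ 2 / 2)).
Definition zeta' (j : nat) : C := Cconj (zeta j).
Definition nu (j : nat) : R := sqrt (2 - c j ^ 2).
Definition weight (j : nat) : R -> R -> C :=
  Cexp_lin (nu j * c j) (- nu j) (nu j * x0 j).
Definition soliton_tau (f : nat -> C) (t x : R) : C :=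
  tau (inter zeta zeta') L ones (fun j => weight j t x * f j)%C.
Definition nsoliton (t x : R) : C :=
  (soliton_tau (fun j => zeta j ^ 2) t x * / soliton_tau ones t x)%C.

Hypothesis nodup : NoDup L.
Hypothesis c_range : forall j, In j L -> - sqrt 2 < c j < sqrt 2.
Hypothesis c_inj : forall i j, In i L -> In j L -> i <> j -> c i <> c j.

Lemma sqrt2_sqr : sqrt 2 * sqrt 2 = 2.
Proof. apply sqrt_sqrt; lra. Qed.

Lemma c_sqr_lt_2 j : In j L -> c j ^ 2 < 2.
Proof. intros H; pose proof (c_range j H); pose proof sqrt2_sqr; nra. Qed.

Lemma Im_zeta_pos j : In j L -> 0 < Im (zeta j).
Proof.
intros H; pose proof (c_sqr_lt_2 j H); unfold Im; simpl.
apply sqrt_lt_R0; simpl in *; lra.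
Qed.

Lemma nu_eq j : In j L -> nu j = sqrt 2 * Im (zeta j).
Proof.
intros H; pose proof (c_sqr_lt_2 j H); unfold nu, Im; cbn -[pow].
rewrite <- sqrt_mult by lra; f_equal; lra.
Qed.

Lemma Re_Im_zeta j : In j L ->
  Re (zeta j) = c j / sqrt 2 /\ Re (zeta j) ^ 2 + Im (zeta j) ^ 2 = 1.
Proof.
intros H; pose proof (c_sqr_lt_2 j H); unfold Re, Im; cbn -[pow]; split; trivial.
rewrite pow2_sqrt by lra.
pose proof sqrt2_sqr; pose proof (sqrt_lt_R0 2).
replace ((c j / sqrt 2) ^ 2) with (c j ^ 2 / (sqrt 2 * sqrt 2)) by (field; lra).
rewrite sqrt2_sqr; lra.
Qed.

Lemma zeta'_mult_zeta j : In j L -> (zeta' j * zeta j)%C = 1%C.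
Proof.
intros H; destruct (Re_Im_zeta j H) as [_ E]; unfold zeta'; revert E.
destruct (zeta j) as [a b]; unfold Re, Im; simpl; intros E.
apply injective_projections; simpl; lra.
Qed.

Lemma zeta'_neq_0 j : In j L -> zeta' j <> 0%C.
Proof.
intros H F; pose proof (zeta'_mult_zeta j H) as E.
rewrite F, Cmult_0_l in E; injection E; lra.
Qed.

Lemma generic_zeta : generic zeta zeta' L.
Proof.
split; trivial; intros i j Hi Hj; split.
- intros E; apply (f_equal Im) in E.
  pose proof (Im_zeta_pos i Hi); pose proof (Im_zeta_pos j Hj).
  unfold zeta', Im in *; simpl in *; lra.
- intros Hij E; apply (f_equal Re) in E; unfold zeta', Re in E; simpl in E.
  apply (c_inj i j Hi Hj Hij).
  assert (0 < sqrt 2) by (apply sqrt_lt_R0; lra).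
  apply Rmult_eq_compat_r with (r := sqrt 2) in E.
  revert E; unfold Rdiv; rewrite !Rmult_assoc, Rinv_l by lra; lra.
Qed.

Lemma zeta_neq_zeta' i j : In i L -> In j L -> zeta i <> zeta' j.
Proof. intros Hi Hj; apply (proj2 generic_zeta); trivial. Qed.

Lemma inter_zeta i j : In i L -> In j L ->
  inter zeta zeta' i j = RtoC (Cmod (zeta j - zeta i) ^ 2 / Cmod (zeta j - zeta' i) ^ 2).
Proof.
intros Hi Hj.
pose proof (Csub_neq_0 _ _ (zeta_neq_zeta' j i Hj Hi)) as N.
rewrite RtoC_div.
2: { apply pow_nonzero; intros F; apply N; now apply Cmod_eq_0. }
rewrite !Cmod2_conj, !Cminus_conj; unfold inter, zeta'; now rewrite Cconj_conj.
Qed.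

Lemma weight_pos j t x : exists s, 0 < s /\ weight j t x = RtoC s.
Proof. eexists; split; [|reflexivity]; apply exp_pos. Qed.

Lemma inter_ge_0 i j : In i L -> In j L ->
  exists s, 0 <= s /\ inter zeta zeta' i j = RtoC s.
Proof.
intros Hi Hj; eexists; split; [|now apply inter_zeta].
apply Rmult_le_pos; [apply pow2_ge_0|].
rewrite <- (Rabs_pos_eq (_ ^ 2)) by apply pow2_ge_0.
(* If the denominator vanishes, its inverse is 0 by convention, still nonnegative. *)
destruct (Req_dec (Cmod (zeta j - zeta' i) ^ 2) 0) as [E|E].
- rewrite E, Rabs_R0, Rinv_0; lra.
- left; now apply Rinv_0_lt_compat, Rabs_pos_lt.
Qed.

Lemma soliton_tau_neq_0 t x : soliton_tau ones t x <> 0%C.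
Proof.
destruct (tau_pos (inter zeta zeta') L (fun j => weight j t x * ones j)%C)
  as (s & P & E).
- apply inter_ge_0.
- intros j _; destruct (weight_pos j t x) as (s & P & E).
  exists s; split; [lra|]; rewrite E; unfold ones; ring.
- unfold soliton_tau; rewrite E; intros F; injection F; lra.
Qed.

Lemma smooth_upto_soliton_tau n f : smooth_upto n (soliton_tau f).
Proof.
apply (smooth_upto_tau n _ L (fun j t x => weight j t x * f j)%C); intros j.
apply smooth_upto_mult; [apply smooth_upto_Cexp_lin|apply smooth_upto_const].
Qed.

Lemma smooth_upto_nsoliton n : smooth_upto n nsoliton.
Proof.
apply smooth_upto_mult; [|apply smooth_upto_inv; [apply soliton_tau_neq_0|]];
  apply smooth_upto_soliton_tau.
Qed.

(** The factor f stays free because it serves twice: f = 1 gives T(y), and f_j = z'_j^2 gives y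
    times the companion function. *)
Lemma soliton_tau_expand f y t x : (forall j, In j L -> y <> zeta' j) ->
  soliton_tau (fun j => f j * phi zeta zeta' j y)%C t x =
  (soliton_tau f t x + Csum L (fun j => (zeta' j - zeta j) / (y - zeta' j) *
    (weight j t x * f j) * soliton_tau (fun i => f i * phi zeta zeta' i (zeta j)) t x))%C.
Proof.
intros Hy.
assert (E : forall y', soliton_tau (fun j => f j * phi zeta zeta' j y')%C t x =
  tau (inter zeta zeta') L ones (fun j => weight j t x * f j * phi zeta zeta' j y')%C).
{ intros; apply tau_ext; intros; trivial; ring. }
rewrite E, (tau_partial_fractions zeta zeta' L generic_zeta) by trivial.
f_equal; apply Csum_ext; intros j Hj; now rewrite E.
Qed.

(** * Residues of the wave function and of its companion *)

Definition residue (j : nat) (t x : R) : C :=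
  ((zeta' j - zeta j) * weight j t x *
   (soliton_tau (fun i => ones i * phi zeta zeta' i (zeta j)) t x *
    / soliton_tau ones t x))%C.

(** The residue s_j of the companion function is (z'_j - z_j) E_j times its value at z_j. The inner
    factor z'_j = 1 / z_j divides the quotient of tau functions, which is y times the companion, by
    y = z_j. *)
Definition residue' (j : nat) (t x : R) : C :=
  ((zeta' j - zeta j) * weight j t x * (zeta' j *
   (soliton_tau (fun i => zeta' i ^ 2 * phi zeta zeta' i (zeta j)) t x *
    / soliton_tau ones t x)))%C.

Lemma smooth_upto_residue n j : smooth_upto n (residue j).
Proof.
repeat apply smooth_upto_mult; try apply smooth_upto_const;
  [apply smooth_upto_Cexp_lin|apply smooth_upto_soliton_tau|].
apply smooth_upto_inv; [apply soliton_tau_neq_0|apply smooth_upto_soliton_tau].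
Qed.

Lemma soliton_tau_ext f g t x : (forall j, In j L -> f j = g j) ->
  soliton_tau f t x = soliton_tau g t x.
Proof.
intros H; apply tau_ext; intros; trivial; rewrite H; trivial.
Qed.

Lemma soliton_tau_expand_ones y t x : (forall j, In j L -> y <> zeta' j) ->
  (soliton_tau (fun j => ones j * phi zeta zeta' j y) t x * / soliton_tau ones t x =
   1 + Csum L (fun j => residue j t x / (y - zeta' j)))%C.
Proof.
intros Hy; rewrite soliton_tau_expand by trivial.
pose proof (soliton_tau_neq_0 t x) as N.
rewrite Cmult_plus_distr_r, Cinv_r by trivial; f_equal.
rewrite Cmult_comm, <- Csum_scal; apply Csum_ext; intros j Hj.
unfold residue, Cdiv.
replace (weight j t x * ones j)%C with (weight j t x) by (unfold ones; ring).
ring.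
Qed.

(** The residues are defined through T(z_j), so evaluating the expansion of T at y = z_j closes into
    a linear system. *)
Lemma residue_eq j t x : In j L ->
  (residue j t x = (zeta' j - zeta j) * weight j t x *
    (1 + Csum L (fun k => residue k t x / (zeta j - zeta' k))))%C.
Proof.
intros Hj; rewrite <- soliton_tau_expand_ones; trivial.
intros; now apply zeta_neq_zeta'.
Qed.

Lemma phi_0 j : In j L -> phi zeta zeta' j 0 = (zeta j ^ 2)%C.
Proof.
intros Hj; pose proof (zeta'_mult_zeta j Hj) as E; pose proof (zeta'_neq_0 j Hj).
assert (H0 : (0 - zeta' j)%C <> 0%C) by (apply Csub_neq_0; auto).
unfold phi; transitivity (zeta j * (zeta' j * zeta j) / zeta' j)%C.
- rewrite E; field; auto.
- field; trivial.
Qed.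

Lemma nsoliton_residue t x :
  nsoliton t x = (1 - Csum L (fun j => residue j t x / zeta' j))%C.
Proof.
unfold nsoliton.
rewrite (soliton_tau_ext _ (fun j => ones j * phi zeta zeta' j 0)%C).
2: { intros j Hj; rewrite phi_0 by trivial; unfold ones; ring. }
rewrite soliton_tau_expand_ones.
2: { intros j Hj F; now apply (zeta'_neq_0 j Hj). }
transitivity (1 + - (1) * Csum L (fun j => residue j t x / zeta' j))%C; [f_equal|ring].
rewrite <- Csum_scal; apply Csum_ext; intros j Hj.
pose proof (zeta'_neq_0 j Hj); assert ((0 - zeta' j)%C <> 0%C) by (apply Csub_neq_0; auto).
field; auto.
Qed.

(** Weights and interaction coefficients are real, so conjugation acts only on the z_j^2. *)
Lemma nsoliton_conj t x :
  Cconj (nsoliton t x) =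
  (soliton_tau (fun j => zeta' j ^ 2) t x * / soliton_tau ones t x)%C.
Proof.
assert (K : forall f, Cconj (soliton_tau f t x) = soliton_tau (fun j => Cconj (f j)) t x).
{ intros f; unfold soliton_tau; rewrite tau_conj.
  - apply tau_ext; intros j Hj.
    + unfold ones; apply injective_projections; simpl; ring.
    + rewrite Cmult_conj; f_equal.
      unfold weight, Cexp_lin; apply injective_projections; simpl; ring.
  - intros i j Hi Hj; rewrite inter_zeta by trivial.
    apply injective_projections; simpl; ring. }
unfold nsoliton; rewrite Cmult_conj, Cinv_conj, !K by apply soliton_tau_neq_0.
f_equal; [|f_equal]; apply soliton_tau_ext; intros j _.
- apply Cpow_conj.
- unfold ones; apply injective_projections; simpl; ring.
Qed.

Lemma residue'_expand y t x : (forall j, In j L -> y <> zeta' j) ->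
  (soliton_tau (fun j => zeta' j ^ 2 * phi zeta zeta' j y) t x * / soliton_tau ones t x =
   Cconj (nsoliton t x) +
   Csum L (fun j => residue' j t x * zeta' j / (y - zeta' j)))%C.
Proof.
intros Hy; rewrite soliton_tau_expand, nsoliton_conj by trivial.
rewrite Cmult_plus_distr_r; f_equal.
rewrite Cmult_comm, <- Csum_scal; apply Csum_ext; intros j Hj.
unfold residue'; unfold Cdiv; simpl; ring.
Qed.

(** At y = 0 the factor z'_j^2 phi_j(0) equals 1, so the quotient of tau functions is 1 there. *)
Lemma nsoliton_conj_residue' t x :
  Cconj (nsoliton t x) = (1 + Csum L (fun j => residue' j t x))%C.
Proof.
assert (E := residue'_expand 0 t x).
rewrite (soliton_tau_ext _ ones), Cinv_r in E.
- rewrite E; [|intros j Hj F; now apply (zeta'_neq_0 j Hj)].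
  rewrite <- Cplus_assoc, <- Csum_plus.
  rewrite Csum_zero; [ring|]; intros j Hj.
  pose proof (zeta'_neq_0 j Hj).
  assert ((0 - zeta' j)%C <> 0%C) by (apply Csub_neq_0; auto).
  field; auto.
- apply soliton_tau_neq_0.
- intros j Hj; rewrite phi_0 by trivial.
  pose proof (zeta'_mult_zeta j Hj) as E'.
  transitivity ((zeta' j * zeta j) * (zeta' j * zeta j))%C; [simpl; ring|].
  rewrite E'; unfold ones; ring.
Qed.

Lemma residue'_eq j t x : In j L ->
  (residue' j t x = (zeta' j - zeta j) * weight j t x *
    (zeta' j + Csum L (fun k => residue' k t x / (zeta j - zeta' k))))%C.
Proof.
intros Hj; unfold residue' at 1; rewrite residue'_expand.
2: { intros; now apply zeta_neq_zeta'. }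
f_equal; rewrite nsoliton_conj_residue'.
rewrite <- Cplus_assoc, <- Csum_plus, Cmult_plus_distr_l, Cmult_1_r; f_equal.
rewrite <- Csum_scal; apply Csum_ext; intros k Hk.
pose proof (Csub_neq_0 _ _ (zeta_neq_zeta' j k Hj Hk)).
transitivity (residue' k t x * (zeta' j * zeta j) / (zeta j - zeta' k))%C.
- field; trivial.
- rewrite zeta'_mult_zeta by trivial; field; trivial.
Qed.

(** The constant b of the Lax pair: i k = b y for k = y / sqrt 2. *)
Definition wave : C := (Ci * RtoC (/ sqrt 2))%C.

Lemma sqrt2_neq_0 : sqrt 2 <> 0.
Proof. pose proof (sqrt_lt_R0 2); lra. Qed.

(** Together with [weight_rate_t], this says that E_j is, up to a constant, the quotient of the
    plane wave e^{b y x + i b^2 y^2 t} at y = z_j by the same wave at y = z'_j. *)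
Lemma weight_rate_x j : In j L -> RtoC (- nu j) = (wave * (zeta j - zeta' j))%C.
Proof.
intros Hj; rewrite nu_eq by trivial; unfold wave, zeta', Im.
pose proof sqrt2_sqr as S; pose proof sqrt2_neq_0 as N.
destruct (zeta j) as [a b]; apply injective_projections; simpl; [|ring].
assert (Q : sqrt 2 = 2 * / sqrt 2).
{ rewrite <- (Rmult_1_r (sqrt 2)) at 1.
  now rewrite <- (Rinv_r (sqrt 2) N), <- Rmult_assoc, S. }
set (q := / sqrt 2) in *; rewrite Q; ring.
Qed.

Lemma weight_rate_t j : In j L ->
  RtoC (nu j * c j) = (Ci * wave ^ 2 * (zeta j ^ 2 - zeta' j ^ 2))%C.
Proof.
intros Hj; rewrite nu_eq by trivial; unfold wave, zeta'.
destruct (Re_Im_zeta j Hj) as [E _]; revert E.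
pose proof sqrt2_sqr as S; pose proof sqrt2_neq_0 as N.
unfold Re, Im; destruct (zeta j) as [a b]; simpl fst; simpl snd; intros E.
replace (c j) with (a * sqrt 2) by (rewrite E; field; trivial).
assert (S' : / sqrt 2 * / sqrt 2 = / 2) by (rewrite <- Rinv_mult, S; trivial).
apply injective_projections; simpl.
- replace (sqrt 2 * b * (a * sqrt 2)) with (sqrt 2 * sqrt 2 * (a * b)) by ring.
  rewrite S; set (q := / sqrt 2) in *.
  transitivity (4 * (q * q) * (a * b)); [rewrite S'; field|ring].
- ring.
Qed.

(** The product rule with the weight factored out, the shape that the flow lemmas expect. *)
Lemma is_derive_weighted (K lam : C) (w g : R -> C) (y : R) (g' : C) :
  @is_derive R_AbsRing C_R_NormedModule w y (lam * w y)%C ->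
  @is_derive R_AbsRing C_R_NormedModule g y g' ->
  @is_derive R_AbsRing C_R_NormedModule (fun s => K * w s * g s)%C y
    (K * w y * (lam * g y + g'))%C.
Proof.
intros Hw Hg.
replace (K * w y * (lam * g y + g'))%C with
  (K * (lam * w y) * g y + K * w y * g')%C by ring.
apply (is_derive_C_mult (fun s => K * w s)%C g); trivial.
now apply is_derive_C_scal.
Qed.

Lemma weight_partial_t j t x : In j L ->
  @is_derive R_AbsRing C_R_NormedModule (fun s => weight j s x) t
    (Ci * wave ^ 2 * (zeta j ^ 2 - zeta' j ^ 2) * weight j t x)%C.
Proof. intros Hj; rewrite <- weight_rate_t by trivial; apply Cexp_lin_partial_t. Qed.

Lemma weight_partial_x j t x : In j L ->
  @is_derive R_AbsRing C_R_NormedModule (fun y => weight j t y) x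
    (wave * (zeta j - zeta' j) * weight j t x)%C.
Proof. intros Hj; rewrite <- weight_rate_x by trivial; apply Cexp_lin_partial_x. Qed.

Lemma residue_partial_t j : is_partial_t (residue j) (dt (residue j)).
Proof. apply (smooth_upto_dt 0), smooth_upto_residue. Qed.

Lemma residue_partial_x j : is_partial_x (residue j) (dx (residue j)).
Proof. apply (smooth_upto_dx 0), smooth_upto_residue. Qed.

Lemma residue_partial_xx j : is_partial_x (dx (residue j)) (dx (dx (residue j))).
Proof. apply (smooth_upto_dx 0), smooth_upto_dx, smooth_upto_residue. Qed.

Let S (f : nat -> C) (j : nat) : C := Csum L (fun m => f m / (zeta j - zeta' m))%C.

(** The linear system [residue_eq] is differentiated, rather than the explicit quotient; uniqueness
    of the derivative concludes. *)
Lemma residue_dt j t x : In j L ->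
  (dt (residue j) t x = (zeta' j - zeta j) * weight j t x *
    (Ci * wave ^ 2 * (zeta j ^ 2 - zeta' j ^ 2) * (1 + S (fun k => residue k t x) j)
     + S (fun k => dt (residue k) t x) j))%C.
Proof.
intros Hj.
apply (is_derive_C_unique (fun s => residue j s x) t); [exact (residue_partial_t j t x)|].
eapply is_derive_ext; [intros s; symmetry; now apply residue_eq|].
apply (is_derive_weighted _ _ (fun s => weight j s x)
  (fun s => 1 + Csum L (fun k => residue k s x / (zeta j - zeta' k)))%C).
- now apply weight_partial_t.
- rewrite <- (Cplus_0_l (S (fun k => dt (residue k) t x) j)).
  apply is_derive_C_plus; [apply is_derive_C_const|].
  apply (is_derive_Csum L (fun k s => residue k s x / (zeta j - zeta' k))%C).
  intros k _; apply is_derive_C_div; exact (residue_partial_t k t x).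
Qed.

Lemma residue_dx j t x : In j L ->
  (dx (residue j) t x = (zeta' j - zeta j) * weight j t x *
    (wave * (zeta j - zeta' j) * (1 + S (fun k => residue k t x) j)
     + S (fun k => dx (residue k) t x) j))%C.
Proof.
intros Hj.
apply (is_derive_C_unique (fun y => residue j t y) x); [exact (residue_partial_x j t x)|].
eapply is_derive_ext; [intros y; symmetry; now apply residue_eq|].
apply (is_derive_weighted _ _ (fun y => weight j t y)
  (fun y => 1 + Csum L (fun k => residue k t y / (zeta j - zeta' k)))%C).
- now apply weight_partial_x.
- rewrite <- (Cplus_0_l (S (fun k => dx (residue k) t x) j)).
  apply is_derive_C_plus; [apply is_derive_C_const|].
  apply (is_derive_Csum L (fun k y => residue k t y / (zeta j - zeta' k))%C).
  intros k _; apply is_derive_C_div; exact (residue_partial_x k t x).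
Qed.

Lemma residue_dxx j t x : In j L ->
  (dx (dx (residue j)) t x = (zeta' j - zeta j) * weight j t x *
    (wave ^ 2 * (zeta j - zeta' j) ^ 2 * (1 + S (fun k => residue k t x) j)
     + 2 * wave * (zeta j - zeta' j) * S (fun k => dx (residue k) t x) j
     + S (fun k => dx (dx (residue k)) t x) j))%C.
Proof.
intros Hj.
set (lam := (wave * (zeta j - zeta' j))%C).
set (g := fun k => residue k t x); set (h := fun k => dx (residue k) t x).
set (q := fun k => dx (dx (residue k)) t x).
(* The right-hand side is regrouped as the product rule applied to [residue_dx]. *)
replace (wave ^ 2 * (zeta j - zeta' j) ^ 2 * (1 + S g j)
  + 2 * wave * (zeta j - zeta' j) * S h j + S q j)%C with
  (lam * (lam * (1 + S g j) + S h j) + (lam * (0 + S h j) + S q j))%C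
  by (unfold lam; simpl; ring).
apply (is_derive_C_unique (fun y => dx (residue j) t y) x); [exact (residue_partial_xx j t x)|].
eapply is_derive_ext; [intros y; symmetry; now apply residue_dx|].
apply (is_derive_weighted _ _ (fun y => weight j t y)
  (fun y => lam * (1 + S (fun k => residue k t y) j) + S (fun k => dx (residue k) t y) j)%C).
- now apply weight_partial_x.
- apply is_derive_C_plus.
  + apply is_derive_C_scal, is_derive_C_plus; [apply is_derive_C_const|].
    apply (is_derive_Csum L (fun k y => residue k t y / (zeta j - zeta' k))%C).
    intros k _; apply is_derive_C_div; exact (residue_partial_x k t x).
  + apply (is_derive_Csum L (fun k y => dx (residue k) t y / (zeta j - zeta' k))%C).
    intros k _; apply is_derive_C_div; exact (residue_partial_xx k t x).
Qed.

Lemma residue_kernel t x (w : nat -> C) :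
  (forall j, In j L -> w j = ((zeta' j - zeta j) * weight j t x *
    Csum L (fun m => w m / (zeta j - zeta' m)))%C) ->
  forall j, In j L -> w j = 0%C.
Proof.
intros H; apply (soliton_system_kernel zeta
  (fun j => exp (nu j * c j * t + - nu j * x + nu j * x0 j))); trivial.
- apply Im_zeta_pos.
- intros; apply exp_pos.
Qed.

(** The constant a is 1 for u and 0 for its x-derivative. *)
Lemma is_derive_residue_sum (f : nat -> R -> C) (y : R) (f' : nat -> C) (a : C) :
  (forall j, In j L -> @is_derive R_AbsRing C_R_NormedModule (f j) y (f' j)) ->
  @is_derive R_AbsRing C_R_NormedModule
    (fun s => a + - (1) * Csum L (fun j => f j s / zeta' j))%C y
    (- Csum L (fun j => f' j / zeta' j))%C.
Proof.
intros H; replace (- Csum L (fun j => f' j / zeta' j))%C with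
  (0 + - (1) * Csum L (fun j => f' j / zeta' j))%C by ring.
apply is_derive_C_plus; [apply is_derive_C_const|].
apply is_derive_C_scal, (is_derive_Csum L (fun j s => f j s / zeta' j)%C).
intros j Hj; now apply is_derive_C_div, H.
Qed.

Lemma nsoliton_GP : GP_solution nsoliton.
Proof.
exists (fun t x => - Csum L (fun j => dt (residue j) t x / zeta' j))%C,
  (fun t x => - Csum L (fun j => dx (residue j) t x / zeta' j))%C,
  (fun t x => - Csum L (fun j => dx (dx (residue j)) t x / zeta' j))%C.
split; [|split; [|split]].
- intros t x.
  apply (is_derive_ext (fun s => 1 + - (1) * Csum L (fun j => residue j s x / zeta' j))%C).
  { intros s; rewrite nsoliton_residue.
    change (@eq C (1 + - (1) * Csum L (fun j => residue j s x / zeta' j))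
      (1 - Csum L (fun j => residue j s x / zeta' j)))%C; ring. }
  apply (is_derive_residue_sum (fun j s => residue j s x));
    intros j _; exact (residue_partial_t j t x).
- intros t x.
  apply (is_derive_ext (fun y => 1 + - (1) * Csum L (fun j => residue j t y / zeta' j))%C).
  { intros y; rewrite nsoliton_residue.
    change (@eq C (1 + - (1) * Csum L (fun j => residue j t y / zeta' j))
      (1 - Csum L (fun j => residue j t y / zeta' j)))%C; ring. }
  apply (is_derive_residue_sum (fun j y => residue j t y));
    intros j _; exact (residue_partial_x j t x).
- intros t x.
  apply (is_derive_ext (fun y => 0 + - (1) * Csum L (fun j => dx (residue j) t y / zeta' j))%C).
  { intros y.
    change (@eq C (0 + - (1) * Csum L (fun j => dx (residue j) t y / zeta' j))
      (- Csum L (fun j => dx (residue j) t y / zeta' j)))%C; ring. }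
  apply (is_derive_residue_sum (fun j y => dx (residue j) t y));
    intros j _; exact (residue_partial_xx j t x).
- intros t x.
  set (k := fun j => ((zeta' j - zeta j) * weight j t x)%C).
  assert (E := lax_flow L zeta zeta' k wave zeta_neq_zeta' zeta'_mult_zeta
    (residue_kernel t x) (fun j => residue j t x) (fun j => dx (residue j) t x)
    (fun j => residue' j t x) (nsoliton t x) (Cconj (nsoliton t x))
    (fun j Hj => residue_eq j t x Hj) (fun j Hj => residue_dx j t x Hj)
    (fun j Hj => residue'_eq j t x Hj) (nsoliton_residue t x)
    (nsoliton_conj_residue' t x)).
  assert (W : (wave ^ 2 = - RtoC (/ 2))%C).
  { unfold wave; pose proof sqrt2_sqr as H2; pose proof sqrt2_neq_0.
    assert (S' : / sqrt 2 * / sqrt 2 = / 2) by (rewrite <- Rinv_mult, H2; trivial).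
    apply injective_projections; simpl; [|ring].
    ring_simplify; simpl; rewrite Rmult_1_r, S'; trivial. }
  rewrite Cmod2_conj.
  (* Since b^2 = - 1 / 2, the identity sum_j r_{j,x} = b (1 - |u|^2) turns - 2 b sum_j r_{j,x} into
     1 - |u|^2. *)
  assert (V : (1 - nsoliton t x * Cconj (nsoliton t x) =
    - (2) * wave * Csum L (fun j => dx (residue j) t x))%C).
  { rewrite E.
    transitivity (- (2) * (wave ^ 2) * (1 - nsoliton t x * Cconj (nsoliton t x)))%C;
      [|simpl; ring].
    rewrite W; replace (- (2) * - RtoC (/ 2))%C with (RtoC 1); [ring|].
    apply injective_projections; simpl; field. }
  assert (F := schroedinger_flow L zeta zeta' k wave zeta_neq_zeta' zeta'_mult_zeta
    (residue_kernel t x) (fun j => residue j t x) (fun j => dt (residue j) t x)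
    (fun j => dx (residue j) t x) (fun j => dx (dx (residue j)) t x) _
    (fun j Hj => residue_eq j t x Hj) (fun j Hj => residue_dt j t x Hj)
    (fun j Hj => residue_dx j t x Hj) (fun j Hj => residue_dxx j t x Hj) V).
  cbv beta in F; rewrite <- (nsoliton_residue t x) in F; exact F.
Qed.

End NSoliton.

(** * Asymptotics *)

Fixpoint Cprod (L : list nat) (f : nat -> C) : C :=
  match L with
  | nil => 1%C
  | j :: L' => (f j * Cprod L' f)%C
  end.

Lemma Cprod_ext L (f g : nat -> C) :
  (forall j, In j L -> f j = g j) -> Cprod L f = Cprod L g.
Proof.
induction L as [|j L IH]; intros H; simpl; trivial.
rewrite H, IH; auto with datatypes.
Qed.

(** Each index contributes either v_j or w_j to every term, hence exactly one factor s_j. *)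
Lemma tau_homogeneous (a : nat -> nat -> C) L (s v w : nat -> C) :
  tau a L (fun j => s j * v j)%C (fun j => s j * w j)%C = (Cprod L s * tau a L v w)%C.
Proof.
revert w; induction L as [|i L IH]; intros w; simpl; [ring|].
rewrite IH.
rewrite (tau_ext a L (fun j => s j * v j)%C (fun j => s j * v j)%C
    (fun j => s j * w j * a i j)%C (fun j => s j * (w j * a i j))%C);
  [rewrite IH; ring|trivial|intros; ring].
Qed.

Lemma tau_all_in (a : nat -> nat -> C) L (v w f : nat -> C) : (forall j, In j L -> v j = 0%C) ->
  tau a L v (fun j => w j * f j)%C = (Cprod L f * tau a L v w)%C.
Proof.
intros Hv; rewrite <- tau_homogeneous; apply tau_ext; intros j Hj; [rewrite Hv by trivial|]; ring.
Qed.

Lemma tau_app_out (a : nat -> nat -> C) L M (v w : nat -> C) :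
  (forall j, In j L -> v j = 1%C) -> (forall j, In j L -> w j = 0%C) ->
  tau a (L ++ M) v w = tau a M v w.
Proof.
revert w; induction L as [|i L IH]; intros w Hv Hw; simpl; trivial.
rewrite Hv, Hw, IH by auto with datatypes; ring.
Qed.

(** All of L must belong to the subset, so each index of M meets every index of L. *)
Lemma tau_app_in (a : nat -> nat -> C) L M (v w : nat -> C) : (forall j, In j L -> v j = 0%C) ->
  tau a (L ++ M) v w =
  (tau a L v w * tau a M v (fun j => w j * Cprod L (fun i => a i j)))%C.
Proof.
revert w; induction L as [|i L IH]; intros w Hv; simpl.
- rewrite Cmult_1_l; apply tau_ext; intros; trivial; ring.
- rewrite Hv, (IH (fun j => w j * a i j)%C) by auto with datatypes.
  rewrite (tau_ext a M v v (fun j => w j * a i j * Cprod L (fun i0 => a i0 j))%C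
    (fun j => w j * (a i j * Cprod L (fun i0 => a i0 j)))%C);
  [ring|trivial|intros; ring].
Qed.

Lemma tau_all_in_neq_0 (a : nat -> nat -> C) L (v w : nat -> C) : NoDup L ->
  (forall i j, In i L -> In j L -> i <> j -> a i j <> 0%C) ->
  (forall j, In j L -> v j = 0%C) -> (forall j, In j L -> w j <> 0%C) ->
  tau a L v w <> 0%C.
Proof.
revert w; induction L as [|i L IH]; intros w HN Ha Hv Hw; simpl.
- intros F; injection F; lra.
- rewrite Hv by auto with datatypes.
  inversion HN as [|? ? Hi HN']; subst.
  rewrite Cmult_0_l, Cplus_0_l.
  apply Cmult_neq_0; [auto with datatypes|apply IH; auto with datatypes].
  intros j Hj; apply Cmult_neq_0; [auto with datatypes|].
  apply Ha; auto with datatypes; now intros <-.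
Qed.

Lemma filterlim_tau {T : Type} {F : (T -> Prop) -> Prop} {FF : Filter F} a L
  (v w : nat -> T -> C) (v0 w0 : nat -> C) :
  (forall j, In j L -> filterlim (v j) F (locally (v0 j))) ->
  (forall j, In j L -> filterlim (w j) F (locally (w0 j))) ->
  filterlim (fun t => tau a L (fun j => v j t) (fun j => w j t)) F
    (locally (tau a L v0 w0)).
Proof.
revert w w0; induction L as [|i L IH]; intros w w0 Hv Hw; simpl;
  [apply filterlim_const|].
apply filterlim_C_plus; apply filterlim_C_mult; auto with datatypes.
apply (IH (fun j t => w j t * a i j)%C (fun j => w0 j * a i j)%C); auto with datatypes.
intros j Hj; apply filterlim_C_mult; [auto with datatypes|apply filterlim_const].
Qed.

(* Rescaling by [s] makes sense of the limit of a quotient of tau functions when some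
   weights tend to infinity. *)
Lemma filterlim_tau_quotient {T : Type} {F : (T -> Prop) -> Prop} {FF : Filter F}
  a L (w s : nat -> T -> C) (v0 w0 f : nat -> C) :
  (forall j t, In j L -> s j t <> 0%C) ->
  (forall j, In j L -> filterlim (s j) F (locally (v0 j))) ->
  (forall j, In j L -> filterlim (fun t => s j t * w j t)%C F (locally (w0 j))) ->
  (forall t, tau a L ones (fun j => w j t * ones j)%C <> 0%C) ->
  tau a L v0 w0 <> 0%C ->
  filterlim (fun t => tau a L ones (fun j => w j t * f j)
      * / tau a L ones (fun j => w j t * ones j))%C F
    (locally (tau a L v0 (fun j => w0 j * f j) * / tau a L v0 w0)%C).
Proof.
intros Hs Hv Hw H0 HN.
assert (P : forall t, Cprod L (fun j => s j t) <> 0%C).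
{ clear - Hs; intros t; induction L as [|i L IH]; simpl; [intros F'; injection F'; lra|].
  apply Cmult_neq_0; auto with datatypes. }
assert (E : forall (g : nat -> C) t,
  tau a L (fun j => s j t) (fun j => s j t * w j t * g j)%C =
  (Cprod L (fun j => s j t) * tau a L ones (fun j => w j t * g j))%C).
{ intros g t; rewrite <- tau_homogeneous.
  apply tau_ext; intros; unfold ones; ring. }
assert (K : filterlim (fun t => tau a L (fun j => s j t) (fun j => s j t * w j t * ones j)%C)
  F (locally (tau a L v0 w0))).
{ rewrite (tau_ext a L v0 v0 w0 (fun j => w0 j * ones j)%C)
    by (intros; unfold ones; try ring; trivial).
  apply (filterlim_tau a L s (fun j t => s j t * w j t * ones j)%C); trivial.
  intros; apply filterlim_C_mult; auto; apply filterlim_const. }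
assert (K' : filterlim (fun t => tau a L (fun j => s j t) (fun j => s j t * w j t * f j)%C)
  F (locally (tau a L v0 (fun j => w0 j * f j)%C))).
{ apply (filterlim_tau a L s (fun j t => s j t * w j t * f j)%C); trivial.
  intros; apply filterlim_C_mult; auto; apply filterlim_const. }
apply (filterlim_ext (fun t =>
  tau a L (fun j => s j t) (fun j => s j t * w j t * f j) *
  / tau a L (fun j => s j t) (fun j => s j t * w j t * ones j))%C).
- intros t; rewrite !E.
  pose proof (P t); pose proof (H0 t).
  field; split; trivial.
- apply filterlim_C_mult; trivial; now apply filterlim_C_inv.
Qed.

(** Indices before k are excluded and those after k forced in, so only two subsets survive, with and
    without k. [tau_one_free_right] is the mirror case. *)
Lemma tau_one_free_left (a : nat -> nat -> C) L1 k L3 (v w f : nat -> C) :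
  (forall j, In j L1 -> v j = 1%C) -> (forall j, In j L1 -> w j = 0%C) ->
  v k = 1%C -> (forall j, In j L3 -> v j = 0%C) ->
  tau a (L1 ++ k :: L3) v (fun j => w j * f j)%C =
  (Cprod L3 f * (1 + f k * (w k * Cprod L3 (a k))) * tau a L3 v w)%C.
Proof.
intros H1 H2 H3 H4; rewrite tau_app_out; trivial.
2: { intros j Hj; rewrite H2 by trivial; ring. }
simpl; rewrite H3, !tau_all_in by trivial; ring.
Qed.

Lemma tau_one_free_right (a : nat -> nat -> C) L1 k L3 (v w f : nat -> C) :
  (forall j, In j L1 -> v j = 0%C) -> v k = 1%C ->
  (forall j, In j L3 -> v j = 1%C) -> (forall j, In j L3 -> w j = 0%C) ->
  tau a (L1 ++ k :: L3) v (fun j => w j * f j)%C =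
  (Cprod L1 f * (1 + f k * (w k * Cprod L1 (fun i => a i k))) * tau a L1 v w)%C.
Proof.
intros H1 H2 H3 H4; rewrite tau_app_in, tau_all_in by trivial.
simpl; rewrite H2.
assert (E : forall w' : nat -> C, (forall j, In j L3 -> w' j = 0%C) -> tau a L3 v w' = 1%C).
{ intros w' Hw'; now rewrite <- (app_nil_r L3), tau_app_out. }
rewrite !E; [ring| |]; intros j Hj; rewrite H4 by trivial; ring.
Qed.

(** * Phases, exponentials and the one-soliton profile *)

Lemma expi_plus a b : expi (a + b) = (expi a * expi b)%C.
Proof.
unfold expi; rewrite cos_plus, sin_plus; apply injective_projections; simpl; ring.
Qed.

Lemma expi_mult_conj a : (expi a * Cconj (expi a) = 1)%C.
Proof.
pose proof (sin2_cos2 a) as H; unfold Rsqr in H.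
apply injective_projections; simpl; lra.
Qed.

Fixpoint Rsum (L : list nat) (f : nat -> R) : R :=
  match L with
  | nil => 0
  | j :: L' => f j + Rsum L' f
  end.

(** The bound n >= 1 keeps the truncated n + 0 - 1 below n, so that d = 0 is an empty sum. *)
Lemma sum_n_m_Rsum (f : nat -> R) d n :
  (1 <= n)%nat -> sum_n_m f n (n + d - 1) = Rsum (seq n d) f.
Proof.
revert n; induction d as [|d IH]; intros n Hn; simpl.
- apply (sum_n_m_zero f); lia.
- rewrite sum_Sn_m by lia.
  replace (n + S d - 1)%nat with (S n + d - 1)%nat by lia.
  now rewrite IH by lia.
Qed.

Lemma expi_Rsum L f :
  expi (2 * Rsum L f) = Cprod L (fun j => expi (f j) ^ 2)%C.
Proof.
induction L as [|j L IH]; cbn [Rsum Cprod].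
- rewrite Rmult_0_r; unfold expi; now rewrite cos_0, sin_0.
- rewrite <- IH, Rmult_plus_distr_l.
  replace (2 * f j) with (f j + f j) by ring.
  rewrite !expi_plus; ring.
Qed.

Lemma Cprod_exp L (f : nat -> C) (g : nat -> R) :
  (forall j, In j L -> f j = RtoC (exp (- g j))) ->
  Cprod L f = RtoC (exp (- Rsum L g)).
Proof.
induction L as [|j L IH]; intros H; simpl.
- now rewrite Ropp_0, exp_0.
- rewrite H, IH by auto with datatypes.
  now rewrite Ropp_plus_distr, exp_plus, RtoC_mult.
Qed.

Lemma tanh_exp q : tanh q = (1 - exp (- (2 * q))) / (1 + exp (- (2 * q))).
Proof.
unfold tanh, sinh, cosh.
pose proof (exp_pos q); pose proof (exp_pos (- q)).
replace (- (2 * q)) with (- q + - q) by ring; rewrite exp_plus.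
assert (E : exp q * exp (- q) = 1) by (rewrite <- exp_plus, Rplus_opp_r; apply exp_0).
replace (exp q) with (/ exp (- q)) by (rewrite exp_Ropp, Rinv_inv; trivial).
field; split; nra.
Qed.

(** As |z| = 1, multiplying the right side by conj z gives i (conj z + z e) / (1 + e). With z = g +
    i s this is s (1 - e) / (1 + e) + i g, the profile written with [tanh_exp]. *)
Lemma soliton_exp c y : c ^ 2 < 2 ->
  let z : C := (c / sqrt 2, sqrt (1 - c ^ 2 / 2)) in
  let e := RtoC (exp (- (sqrt (2 - c ^ 2) * y))) in
  (z * soliton c y = Ci * ((1 + z ^ 2 * e) * / (1 + e)))%C.
Proof.
intros Hc z e; unfold soliton.
pose proof sqrt2_sqr as S2; pose proof sqrt2_neq_0 as N2.
assert (Hs : sqrt (1 - c ^ 2 / 2) * sqrt (1 - c ^ 2 / 2) = 1 - c ^ 2 / 2)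
  by (apply sqrt_sqrt; lra).
assert (Hnu : sqrt (2 - c ^ 2) = sqrt 2 * sqrt (1 - c ^ 2 / 2))
  by (rewrite <- sqrt_mult by lra; f_equal; lra).
rewrite tanh_exp.
replace (2 * (sqrt (1 - c ^ 2 / 2) * (y / sqrt 2))) with (sqrt (2 - c ^ 2) * y).
2: { rewrite Hnu; apply (Rmult_eq_reg_r (sqrt 2)); trivial.
  transitivity (sqrt 2 * sqrt 2 * (sqrt (1 - c ^ 2 / 2) * y)); [ring|].
  rewrite S2; field; trivial. }
assert (Hcs : c / sqrt 2 * (c / sqrt 2) = c ^ 2 / 2).
{ transitivity (c ^ 2 / (sqrt 2 * sqrt 2)); [field; trivial|now rewrite S2]. }
unfold e; pose proof (exp_pos (- (sqrt (2 - c ^ 2) * y))) as P; clear e.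
set (e := exp (- (sqrt (2 - c ^ 2) * y))) in *.
unfold z; clear z; set (s := sqrt (1 - c ^ 2 / 2)) in *; set (g := c / sqrt 2) in *.
assert (G : g * g = 1 - s * s) by lra.
replace (/ (1 + RtoC e))%C with (RtoC (/ (1 + e))).
2: { rewrite <- RtoC_plus, RtoC_inv; trivial; lra. }
unfold Rdiv; set (d := / (1 + e)).
assert (D : (1 + e) * d = 1) by (unfold d; field; lra).
assert (H1 : g * g * (1 + e) * d = 1 - s * s) by (rewrite Rmult_assoc, D; lra).
clearbody s g d; clear - D G.
apply injective_projections; simpl.
- assert (D' : d = 1 - e * d) by lra. 
  transitivity (s * g * ((1 - e) * d - (1 + e) * d)); [rewrite D; ring|ring].
- transitivity (s * s * ((1 - e) * d) + g * g * ((1 + e) * d)); [rewrite D; ring|].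
  transitivity ((1 + (g * g - s * s) * e) * d); [|ring].
  replace (g * g) with (1 - s * s) by lra; ring.
Qed.

Lemma filterlim_exp_lin_p (a b : R) : a < 0 ->
  filterlim (fun t => RtoC (exp (a * t + b))) (Rbar_locally p_infty) (locally (RtoC 0)).
Proof.
intros Ha; apply filterlim_C_iff; simpl; split; [|apply filterlim_const].
apply (filterlim_comp _ _ _ (fun t => a * t + b) exp _ (Rbar_locally m_infty)).
- intros P [M HM]; exists ((M - b) / a); intros t Ht; apply HM.
  apply (Rmult_lt_gt_compat_neg_l a) in Ht; trivial.
  replace (a * ((M - b) / a)) with (M - b) in Ht by (field; lra); lra.
- exact is_lim_exp_m.
Qed.

Lemma filterlim_exp_lin_m (a b : R) : 0 < a ->
  filterlim (fun t => RtoC (exp (a * t + b))) (Rbar_locally m_infty) (locally (RtoC 0)).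
Proof.
intros Ha; apply filterlim_C_iff; simpl; split; [|apply filterlim_const].
apply (filterlim_comp _ _ _ (fun t => a * t + b) exp _ (Rbar_locally m_infty)).
- intros P [M HM]; exists ((M - b) / a); intros t Ht; apply HM.
  apply (Rmult_lt_compat_l a) in Ht; trivial.
  replace (a * ((M - b) / a)) with (M - b) in Ht by (field; lra); lra.
- exact is_lim_exp_m.
Qed.

Lemma log_term_sym c j k : log_term c j k = log_term c k j.
Proof. unfold log_term; f_equal; f_equal; ring. Qed.

Lemma expi_theta c j : - sqrt 2 < c j < sqrt 2 -> expi (theta c j) = zeta c j.
Proof.
intros H; pose proof sqrt2_sqr as S; pose proof sqrt2_neq_0 as N.
assert (P : 0 < sqrt 2) by (apply sqrt_lt_R0; lra).
assert (B : -1 <= c j / sqrt 2 <= 1).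
{ split; apply (Rmult_le_reg_r (sqrt 2)); trivial; unfold Rdiv;
    rewrite Rmult_assoc, Rinv_l, Rmult_1_r by trivial; lra. }
unfold expi, theta, zeta; rewrite cos_acos, sin_acos by trivial.
f_equal; f_equal; f_equal; unfold Rsqr.
transitivity (c j ^ 2 / (sqrt 2 * sqrt 2)); [field; trivial|now rewrite S].
Qed.

Section Asymptotics.

Variables (c x0 : nat -> R) (L : list nat).

Hypothesis nodup : NoDup L.
Hypothesis c_range : forall j, In j L -> - sqrt 2 < c j < sqrt 2.
Hypothesis c_inj : forall i j, In i L -> In j L -> i <> j -> c i <> c j.

Lemma nu_pos j : In j L -> 0 < nu c j.
Proof.
intros H; apply sqrt_lt_R0; pose proof (c_sqr_lt_2 c L c_range j H); lra.
Qed.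

(** Since |z_i| = |z_j| = 1, c_i c_j = 2 Re z_i Re z_j and nu_i nu_j = 2 Im z_i Im z_j, the two
    squared moduli in a_ij are 2 - c_i c_j -+ nu_i nu_j: the ratio in the logarithm, inverted. *)
Lemma inter_log i j : In i L -> In j L -> i <> j ->
  inter (zeta c) (zeta' c) i j = RtoC (exp (- log_term c j i)).
Proof.
intros Hi Hj Hij; rewrite (inter_zeta c L) by trivial; f_equal.
assert (M : forall k, Cmod (zeta c j - k) ^ 2 =
  (Re (zeta c j) - Re k) ^ 2 + (Im (zeta c j) - Im k) ^ 2).
{ intros k; unfold Cmod; rewrite pow2_sqrt; trivial.
  apply Rplus_le_le_0_compat; apply pow2_ge_0. }
destruct (Re_Im_zeta c L c_range i Hi) as [Ri Ni].
destruct (Re_Im_zeta c L c_range j Hj) as [Rj Nj].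
assert (Ci2 : c i = sqrt 2 * Re (zeta c i)) by (rewrite Ri; field; apply sqrt2_neq_0).
assert (Cj2 : c j = sqrt 2 * Re (zeta c j)) by (rewrite Rj; field; apply sqrt2_neq_0).
pose proof (nu_eq c L c_range i Hi) as Ui; pose proof (nu_eq c L c_range j Hj) as Uj.
pose proof (Im_zeta_pos c L c_range i Hi) as Pi.
pose proof (Im_zeta_pos c L c_range j Hj) as Pj.
pose proof (c_inj i j Hi Hj Hij) as Hne.
unfold nu in Ui, Uj; unfold log_term; rewrite Ui, Uj.
pose proof sqrt2_sqr as S2.
assert (Ecc : c j * c i = 2 * (Re (zeta c j) * Re (zeta c i))).
{ rewrite Cj2 at 1; rewrite Ci2 at 1.
  rewrite <- S2 at 3; ring. }
assert (Euu : sqrt 2 * Im (zeta c j) * (sqrt 2 * Im (zeta c i)) =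
  2 * (Im (zeta c j) * Im (zeta c i))).
{ transitivity (sqrt 2 * sqrt 2 * (Im (zeta c j) * Im (zeta c i))); [ring|].
  now rewrite S2. }
rewrite Ecc, Euu, !M; unfold zeta'; rewrite re_conj, im_conj.
assert (Rne : Re (zeta c i) <> Re (zeta c j)).
{ intros E; apply Hne; now rewrite Ci2, Cj2, E. }
revert Ni Nj Pi Pj Rne; generalize (Re (zeta c i)) (Im (zeta c i)) (Re (zeta c j))
  (Im (zeta c j)); intros p q r s Ni Nj Pp Ps Hpr.
assert (X1 : (r - p) ^ 2 + (s - q) ^ 2 = 2 - 2 * (r * p) - 2 * (s * q)) by (simpl in *; lra).
assert (X2 : (r - p) ^ 2 + (s - - q) ^ 2 = 2 - 2 * (r * p) + 2 * (s * q)) by (simpl in *; lra).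
assert (Y1 : 0 < 2 - 2 * (r * p) - 2 * (s * q)).
{ rewrite <- X1; pose proof (pow2_ge_0 (s - q)).
  assert (0 < (r - p) ^ 2) by (apply pow2_gt_0; lra); lra. }
assert (Y2 : 0 < 2 - 2 * (r * p) + 2 * (s * q)).
{ assert (0 < s * q) by nra; lra. }
rewrite X1, X2, exp_Ropp, exp_ln.
- field; lra.
- now apply Rdiv_lt_0_compat.
Qed.

Lemma inter_zeta_neq_0 i j : In i L -> In j L -> i <> j ->
  inter (zeta c) (zeta' c) i j <> 0%C.
Proof.
intros Hi Hj Hij; rewrite inter_log by trivial; intros F; injection F as F.
pose proof (exp_pos (- log_term c j i)); lra.
Qed.

Lemma weight_moving j k t x :
  weight c x0 j t (x + c k * t) =
  RtoC (exp (nu c j * (c j - c k) * t + nu c j * (x0 j - x))).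
Proof. unfold weight, Cexp_lin; f_equal; f_equal; ring. Qed.

(** [ahead] marks the indices whose weights tend to infinity in the frame of the k-th soliton; these
    are rescaled by their inverse weights. The k-th weight is constant there, and the remaining ones
    tend to 0. *)
Lemma nsoliton_limit {F : (R -> Prop) -> Prop} {FF : Filter F} (ahead : nat -> bool) k x :
  let v0 := fun j => if ahead j then RtoC 0 else RtoC 1 in
  let w0 := fun j => if Nat.eqb j k then RtoC (exp (nu c k * (x0 k - x)))
    else if ahead j then RtoC 1 else RtoC 0 in
  ahead k = false ->
  (forall j, In j L -> j <> k -> forall b,
    filterlim (fun t => RtoC (exp ((if ahead j then - 1 else 1) *
      (nu c j * (c j - c k)) * t + b))) F (locally (RtoC 0))) ->
  tau (inter (zeta c) (zeta' c)) L v0 w0 <> 0%C ->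
  filterlim (fun t => nsoliton c x0 L t (x + c k * t)) F
    (locally (tau (inter (zeta c) (zeta' c)) L v0 (fun j => w0 j * zeta c j ^ 2) *
      / tau (inter (zeta c) (zeta' c)) L v0 w0)%C).
Proof.
intros v0 w0 Hk Hlim HN.
assert (Hw : forall j t y, weight c x0 j t y <> 0%C).
{ intros j t y; destruct (weight_pos c x0 j t y) as (s & P & E); rewrite E.
  intros F'; injection F'; lra. }
apply (filterlim_tau_quotient (inter (zeta c) (zeta' c)) L
  (fun j t => weight c x0 j t (x + c k * t))
  (fun j t => if ahead j then / weight c x0 j t (x + c k * t) else RtoC 1)%C
  v0 w0 (fun j => zeta c j ^ 2)%C); trivial.
- intros j t Hj; destruct (ahead j); [|intros F'; injection F'; lra].
  intros F'; pose proof (Cinv_r _ (Hw j t (x + c k * t))) as E.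
  rewrite F', Cmult_0_r in E; injection E; lra.
- intros j Hj; unfold v0; destruct (ahead j) eqn:Ej; [|apply filterlim_const].
  assert (Hjk : j <> k) by (intros ->; congruence).
  apply (filterlim_ext (fun t => RtoC (exp (- 1 *
      (nu c j * (c j - c k)) * t + - (nu c j * (x0 j - x)))))).
  + intros t; rewrite weight_moving, <- RtoC_inv, <- exp_Ropp.
    * f_equal; f_equal; ring.
    * pose proof (exp_pos (nu c j * (c j - c k) * t + nu c j * (x0 j - x))); lra.
  + generalize (Hlim j Hj Hjk (- (nu c j * (x0 j - x)))); now rewrite Ej.
- intros j Hj; unfold w0; destruct (Nat.eqb_spec j k) as [->|Hjk].
  + rewrite Hk.
    apply (filterlim_ext (fun t => RtoC (exp (nu c k * (x0 k - x)))));
      [|apply filterlim_const].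
    intros t; rewrite weight_moving, Cmult_1_l; f_equal; f_equal; ring.
  + destruct (ahead j) eqn:Ej.
    * apply (filterlim_ext (fun t => RtoC 1)); [|apply filterlim_const].
      intros t; rewrite Cmult_comm, Cinv_r; trivial.
    * apply (filterlim_ext (fun t => RtoC (exp (1 *
        (nu c j * (c j - c k)) * t + nu c j * (x0 j - x))))).
      { intros t; rewrite weight_moving, Cmult_1_l; f_equal; f_equal; ring. }
      generalize (Hlim j Hj Hjk (nu c j * (x0 j - x))); now rewrite Ej.
- intros t; exact (soliton_tau_neq_0 c x0 L nodup c_range c_inj t (x + c k * t)).
Qed.

(** Serves both directions of time: l lists the indices ahead and s sums their logarithms. The tau
    function of l is a common factor, nonzero by [tau_all_in_neq_0], and cancels. *)
Lemma nsoliton_limit_one_free {F : (R -> Prop) -> Prop} {FF : Filter F}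
  (ahead : nat -> bool) k x (l : list nat) (s : R) :
  let W := RtoC (exp (nu c k * (x0 k - x))) in
  let v0 := fun j => if ahead j then RtoC 0 else RtoC 1 in
  let w0 := fun j => if Nat.eqb j k then W else if ahead j then RtoC 1 else RtoC 0 in
  ahead k = false ->
  (forall j, In j L -> j <> k -> forall b,
    filterlim (fun t => RtoC (exp ((if ahead j then - 1 else 1) *
      (nu c j * (c j - c k)) * t + b))) F (locally (RtoC 0))) ->
  NoDup l -> (forall j, In j l -> In j L /\ ahead j = true) ->
  (forall f, tau (inter (zeta c) (zeta' c)) L v0 (fun j => w0 j * f j) =
    Cprod l f * (1 + f k * (W * RtoC (exp (- s)))) *
    tau (inter (zeta c) (zeta' c)) l v0 w0)%C ->
  filterlim (fun t => nsoliton c x0 L t (x + c k * t)) F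
    (locally (Cprod l (fun j => zeta c j ^ 2) *
      ((1 + zeta c k ^ 2 * (W * RtoC (exp (- s)))) * / (1 + W * RtoC (exp (- s)))))%C).
Proof.
intros W v0 w0 Hk Hlim Hl HlL TE.
set (a := inter (zeta c) (zeta' c)) in *.
assert (Hden : (1 + W * RtoC (exp (- s)))%C <> 0%C).
{ unfold W; rewrite <- RtoC_mult, <- RtoC_plus; intros F'; injection F' as F'.
  pose proof (exp_pos (nu c k * (x0 k - x))); pose proof (exp_pos (- s)); nra. }
assert (HT : tau a l v0 w0 <> 0%C).
{ apply tau_all_in_neq_0; trivial.
  - intros i j Hi Hj Hij; apply inter_zeta_neq_0; trivial; now apply HlL.
  - intros j Hj; unfold v0; now rewrite (proj2 (HlL j Hj)).
  - intros j Hj; unfold w0; rewrite (proj2 (HlL j Hj)).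
    destruct (Nat.eqb_spec j k) as [->|_].
    + rewrite (proj2 (HlL k Hj)) in Hk; discriminate.
    + intros F'; injection F'; lra. }
assert (TD : tau a L v0 w0 = ((1 + W * RtoC (exp (- s))) * tau a l v0 w0)%C).
{ rewrite (tau_ext a L v0 v0 w0 (fun j => w0 j * ones j)%C), TE;
    [|trivial|intros; unfold ones; ring].
  replace (Cprod l ones) with (RtoC 1); [unfold ones; ring|].
  clear; induction l as [|j l IH]; simpl; trivial; rewrite <- IH; unfold ones; ring. }
replace (Cprod l _ * _)%C with
  (tau a L v0 (fun j => w0 j * zeta c j ^ 2) * / tau a L v0 w0)%C
  by (rewrite TE, TD; field; split; trivial).
apply nsoliton_limit; trivial.
fold a W v0 w0; rewrite TD; now apply Cmult_neq_0.
Qed.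

End Asymptotics.

(** The factor e^{- s} becomes a translation by - s / nu_k in the exponent, and the factor z_k of
    [soliton_exp] supplies the phase e^{i theta_k}. *)
Lemma asymptotic_soliton_value c x0 theta0 k x (s : R) (Q : C) :
  - sqrt 2 < c k < sqrt 2 ->
  (Ci * expi theta0 * (Q * ((1 + zeta c k ^ 2 * (RtoC (exp (nu c k * (x0 k - x))) *
      RtoC (exp (- s)))) *
    / (1 + RtoC (exp (nu c k * (x0 k - x))) * RtoC (exp (- s))))) =
  expi (theta0 + theta c k) * Q *
    soliton (c k) (x - x0 k - - (1 / sqrt (2 - c k ^ 2)) * s))%C.
Proof.
intros Hc; rewrite expi_plus, expi_theta by trivial.
assert (C2 : c k ^ 2 < 2) by (pose proof sqrt2_sqr; nra).
assert (P : 0 < sqrt (2 - c k ^ 2)) by (apply sqrt_lt_R0; lra).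
set (y := x - x0 k - - (1 / sqrt (2 - c k ^ 2)) * s).
transitivity (expi theta0 * Q * (zeta c k * soliton (c k) y))%C; [|ring].
unfold zeta at 2; rewrite soliton_exp by trivial.
rewrite <- RtoC_mult, <- exp_plus; unfold nu.
replace (- (sqrt (2 - c k ^ 2) * y)) with (sqrt (2 - c k ^ 2) * (x0 k - x) + - s).
- unfold zeta; ring.
- unfold y; field; lra.
Qed.

Theorem theorem1p1 :
  forall (N : nat) (c : nat -> R) (theta0 : R) (x0 : nat -> R),
    (1 <= N)%nat ->
    (forall k : nat, (1 <= k <= N)%nat -> - sqrt 2 < c k < sqrt 2) ->
    (forall j k : nat, (1 <= j)%nat -> (j < k)%nat -> (k <= N)%nat -> c j < c k) ->
    exists u : R -> R -> C,
      smooth u /\ GP_solution u /\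
      forall (x : R) (k : nat), (1 <= k <= N)%nat ->
        filterlim (fun t : R => u t (x + c k * t)) (Rbar_locally p_infty)
          (locally (expi (theta0 + theta c k) * A_plus N c k
                    * soliton (c k) (x - x0 k - eta_plus N c k))%C) /\
        filterlim (fun t : R => u t (x + c k * t)) (Rbar_locally m_infty)
          (locally (expi (theta0 + theta c k) * A_minus c k
                    * soliton (c k) (x - x0 k - eta_minus c k))%C).
Proof.
intros N c theta0 x0 HN Hc Hlt.
set (L := seq 1 N).
assert (HL : forall j, In j L <-> (1 <= j <= N)%nat).
{ intros j; unfold L; rewrite in_seq; lia. }
assert (Hnd : NoDup L) by apply seq_NoDup.
assert (Hr : forall j, In j L -> - sqrt 2 < c j < sqrt 2) by (intros j Hj; now apply Hc, HL).
assert (Hmono : forall i j, In i L -> In j L -> (i < j)%nat -> c i < c j).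
{ intros i j Hi Hj Hij; apply HL in Hi, Hj; apply Hlt; lia. }
assert (Hinj : forall i j, In i L -> In j L -> i <> j -> c i <> c j).
{ intros i j Hi Hj Hij; destruct (Nat.lt_total i j) as [H|[H|H]]; [|lia|];
    apply Hmono in H; trivial; lra. }
assert (Hnu : forall j, In j L -> 0 < nu c j) by (intros j Hj; now apply (nu_pos c L)).
assert (Hz : forall l, (forall j, In j l -> In j L) ->
  Cprod l (fun j => zeta c j ^ 2)%C = expi (2 * Rsum l (theta c))).
{ intros l Hl; rewrite expi_Rsum; apply Cprod_ext; intros j Hj.
  rewrite expi_theta; auto. }
exists (fun t x => Ci * expi theta0 * nsoliton c x0 L t x)%C.
split; [|split].
- intros n; apply smooth_upto_class_Cn.
  apply smooth_upto_mult; [apply smooth_upto_const|now apply smooth_upto_nsoliton].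
- apply GP_solution_phase; [|now apply nsoliton_GP].
  rewrite Cmult_conj.
  transitivity ((Ci * Cconj Ci) * (expi theta0 * Cconj (expi theta0)))%C; [ring|].
  rewrite expi_mult_conj; apply injective_projections; simpl; ring.
- intros x k Hk.
  set (L1 := seq 1 (k - 1)); set (L3 := seq (k + 1) (N - k)).
  assert (EL : L = L1 ++ k :: L3).
  { unfold L, L1, L3; replace N with ((k - 1) + S (N - k))%nat at 1 by lia.
    rewrite seq_app; f_equal; replace (1 + (k - 1))%nat with k by lia.
    simpl; f_equal; f_equal; lia. }
  assert (H1 : forall j, In j L1 -> In j L /\ (j < k)%nat).
  { intros j; unfold L1; rewrite in_seq, HL; lia. }
  assert (H3 : forall j, In j L3 -> In j L /\ (k < j)%nat).
  { intros j; unfold L3; rewrite in_seq, HL; lia. }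
  assert (HkL : In k L) by now apply HL.
  split.
  + unfold A_plus, eta_plus.
    (* The shape required by [sum_n_m_Rsum]; for k = N the sum is empty. *)
    replace N with ((k + 1) + (N - k) - 1)%nat by lia.
    rewrite !sum_n_m_Rsum by lia; fold L3.
    rewrite <- Hz by (intros j Hj; now apply H3).
    rewrite <- asymptotic_soliton_value by auto.
    apply filterlim_C_mult; [apply filterlim_const|].
    (* As t tends to +infinity, the rate nu_j (c_j - c_k) makes the weights of the faster solitons,
       j > k, blow up. *)
    apply (nsoliton_limit_one_free c x0 L Hnd Hr Hinj (fun j => Nat.ltb k j)).
    * apply Nat.ltb_irrefl.
    * intros j Hj Hjk b; apply filterlim_exp_lin_p.
      pose proof (Hnu j Hj); destruct (Nat.ltb_spec k j).
      -- pose proof (Hmono k j HkL Hj ltac:(lia)); nra.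
      -- pose proof (Hmono j k Hj HkL ltac:(lia)); nra.
    * apply seq_NoDup.
    * intros j Hj; rewrite Nat.ltb_lt; now apply H3.
    * intros f.
      rewrite <- (Cprod_exp L3 (inter (zeta c) (zeta' c) k)).
      2: { intros j Hj; apply (inter_log c L); trivial; [now apply H3|].
        apply H3 in Hj; lia. }
      rewrite EL, tau_one_free_left; [now rewrite Nat.eqb_refl| | | |].
      -- intros j Hj; apply H1 in Hj; destruct (Nat.ltb_spec k j); [lia|trivial].
      -- intros j Hj; apply H1 in Hj.
         destruct (Nat.eqb_spec j k), (Nat.ltb_spec k j); try lia; trivial.
      -- now rewrite Nat.ltb_irrefl.
      -- intros j Hj; apply H3 in Hj; destruct (Nat.ltb_spec k j); [trivial|lia].
  + unfold A_minus, eta_minus.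
    replace (k - 1)%nat with (1 + (k - 1) - 1)%nat by lia.
    rewrite !sum_n_m_Rsum by lia; fold L1.
    rewrite <- Hz by (intros j Hj; now apply H1).
    rewrite <- asymptotic_soliton_value by auto.
    apply filterlim_C_mult; [apply filterlim_const|].
    (* As t tends to -infinity, the slower solitons, j < k, have the growing weights. *)
    apply (nsoliton_limit_one_free c x0 L Hnd Hr Hinj (fun j => Nat.ltb j k)).
    * apply Nat.ltb_irrefl.
    * intros j Hj Hjk b; apply filterlim_exp_lin_m.
      pose proof (Hnu j Hj); destruct (Nat.ltb_spec j k).
      -- pose proof (Hmono j k Hj HkL ltac:(lia)); nra.
      -- pose proof (Hmono k j HkL Hj ltac:(lia)); nra.
    * apply seq_NoDup.
    * intros j Hj; rewrite Nat.ltb_lt; now apply H1.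
    * intros f.
      rewrite <- (Cprod_exp L1 (fun i => inter (zeta c) (zeta' c) i k)).
      (* Here k is the second index of the interaction coefficient, whence the symmetry of the
         logarithmic term. *)
      2: { intros j Hj; rewrite log_term_sym; apply (inter_log c L); trivial;
             [now apply H1|]; apply H1 in Hj; lia. }
      rewrite EL, tau_one_free_right; [now rewrite Nat.eqb_refl| | | |].
      -- intros j Hj; apply H1 in Hj; destruct (Nat.ltb_spec j k); [trivial|lia].
      -- now rewrite Nat.ltb_irrefl.
      -- intros j Hj; apply H3 in Hj; destruct (Nat.ltb_spec j k); [lia|trivial].
      -- intros j Hj; apply H3 in Hj.
         destruct (Nat.eqb_spec j k), (Nat.ltb_spec j k); try lia; trivial.
Qed.
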